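(* Let $G$ be an $n$-vertex graph of girth at least $5$ embedded on a surface of Euler genus $g$. Suppose $G$ is DP-$k$-colorable, where $k$ is a power of a prime and $k>2$. If $n\ge 5g$, then $$P_{DP}(G,k)\ge k^{\left(\frac{(n-5g)(k-2)}{3}-(k-3)\right)/(k-1)}.$$
   Context: For a finite set $A$ with $|A|=k$ and symmetric group $S_A$, an $S_A$-labeling of $G$ is $(D,\sigma)$ with $D$ an orientation of $G$ and $\sigma:E(D)\to S_A$; a proper coloring of it is $\kappa:V(G)\to A$ with $\sigma(u,v)(\kappa(u))\ne\kappa(v)$ for every arc $(u,v)$. $G$ is DP-$k$-colorable if every such $S_A$-labeling has a proper coloring. $P_{DP}(G,k)$ is the minimum over all $S_A$-labelings of $G$ of the number of proper colorings. *)

(* Defs.v *)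
From HB Require Import structures.
From mathcomp Require Import all_boot all_order all_algebra all_fingroup.
From mathcomp Require Import all_classical all_reals all_analysis.
Import numFieldNormedType.Exports.
Set Implicit Arguments.
Unset Strict Implicit.
Unset Printing Implicit Defensive.
Import Order.TTheory GRing.Theory Num.Theory.

(* A finite simple graph is a symmetric irreflexive [e : rel V] on [V : finType]. *)

(* [ucycle] also accepts loops and back-and-forth walks [:: x; y], which are not
   cycles of a simple graph; a forest has infinite girth. *)
Definition girth_ge (V : finType) (e : rel V) (l : nat) : Prop :=
  forall s : seq V, 2 < size s -> ucycle e s -> l <= size s.

Definition edges (V : finType) (e : rel V) : {set {set V}} :=
  [set [set p.1; p.2] | p : V * V & e p.1 p.2].

(* DP-coloring *)

(* Exactly one of the arcs (x, y), (y, x) is kept for each edge xy. *)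
Definition is_orientation (V : finType) (e : rel V) (D : {set V * V}) : bool :=
  [forall x, forall y,
     if e x y then ((x, y) \in D) (+) ((y, x) \in D) else (x, y) \notin D].

(* A labeling is a pair (D, sigma).  The function sigma is total on V * V, but only
   its values on the arcs of D matter. *)
Definition labeling (V A : finType) : Type :=
  ({set V * V} * {ffun V * V -> {perm A}})%type.

Definition is_labeling (V A : finType) (e : rel V) (L : labeling V A) : bool :=
  is_orientation e L.1.

Definition proper_coloring (V A : finType) (L : labeling V A)
    (c : {ffun V -> A}) : bool :=
  [forall a in L.1, L.2 a (c a.1) != c a.2].

Definition num_colorings (V A : finType) (L : labeling V A) : nat :=
  #|[set c | proper_coloring L c]|.

Definition DP_colorable (V : finType) (e : rel V) (A : finType) : Prop :=
  forall L : labeling V A, is_labeling e L -> exists c, proper_coloring L c.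

(* The default value #|A| ^ #|V| counts all maps V -> A, hence does not affect the
   minimum; see [P_DP_min] and [P_DP_attained]. *)
Definition P_DP (V : finType) (e : rel V) (A : finType) : nat :=
  \big[minn/#|A| ^ #|V|]_(L : labeling V A | is_labeling e L) num_colorings L.

Lemma P_DP_min (V : finType) (e : rel V) (A : finType) (L : labeling V A) :
  is_labeling e L -> P_DP e A <= num_colorings L.
Proof.
move=> eL; rewrite /P_DP; have := mem_index_enum L.
elim: (index_enum _) => // L' s IH; rewrite inE big_cons => /predU1P[<-|/IH le_s].
  by rewrite eL geq_minl.
by case: ifP => // _; apply: leq_trans (geq_minr _ _) le_s.
Qed.

Lemma P_DP_attained (V : finType) (e : rel V) (A : finType) :
  symmetric e -> irreflexive e ->
  exists2 L : labeling V A, is_labeling e L & P_DP e A = num_colorings L.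
Proof.
move=> se ie.
have num_le (L : labeling V A) : num_colorings L <= #|A| ^ #|V|.
  by rewrite -card_ffun max_card.
pose D0 := [set p : V * V | e p.1 p.2 & enum_rank p.1 < enum_rank p.2].
pose L0 : labeling V A := (D0, [ffun => 1%g]).
have eL0 : is_labeling e L0.
  apply/forallP => x; apply/forallP => y; rewrite !inE /=.
  rewrite (se y x); case exy: (e x y) => //=.
  case: ltngtP => // xy; have: enum_rank x = enum_rank y by exact: val_inj.
  by move/enum_rank_inj => xy'; rewrite xy' ie in exy.
pose Q v := v = #|A| ^ #|V| \/
  exists2 L : labeling V A, is_labeling e L & v = num_colorings L.
have [PE|//] : Q (P_DP e A).
  apply: (big_ind Q) => [|m1 m2 Q1 Q2|L eL]; first by left.
    by rewrite /minn; case: ifP.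
  by right; exists L.
by exists L0 => //; apply/eqP; rewrite eqn_leq P_DP_min //= PE.
Qed.

(* Surfaces *)

Section CombinatorialSurface.
Variables (m : nat) (F : {set {set 'I_m}}).

Definition triangulation_edges : {set {set 'I_m}} :=
  [set d : {set 'I_m} | (#|d| == 2) && [exists t in F, d \subset t]].

Definition link (v : 'I_m) : rel 'I_m :=
  fun a b => (a != b) && ([set v; a; b] \in F).

(* [F] is the set of triangles of a simplicial complex on the vertex set 'I_m. Links
   are 2-regular graphs by the third condition, so a connected one is a cycle. *)
Definition combinatorial_surface : Prop :=
  [/\ forall t, t \in F -> #|t| = 3,
      forall v : 'I_m, exists2 t, t \in F & v \in t,
      forall d, d \in triangulation_edges -> #|[set t in F | d \subset t]| = 2 &
      forall v a b : 'I_m, [set v; a] \in triangulation_edges ->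
        [set v; b] \in triangulation_edges -> connect (link v) a b].

End CombinatorialSurface.

Local Open Scope classical_set_scope.
Local Open Scope ring_scope.

(* Geometric realization in barycentric coordinates. *)
Definition realization (R : realType) (m : nat) (F : {set {set 'I_m}}) :
    set 'rV[R]_m :=
  [set x | [/\ forall i, 0 <= x ord0 i, \sum_i x ord0 i = 1 &
               exists2 t, t \in F & forall i, x ord0 i != 0 -> i \in t]].

Definition homeomorphic (X Y : topologicalType) (A : set X) (B : set Y) : Prop :=
  exists (f : X -> Y) (h : Y -> X),
    [/\ {within A, continuous f} /\ {within B, continuous h},
        (forall x, A x -> B (f x)) /\ (forall y, B y -> A (h y)),
        (forall x, A x -> h (f x) = x) & (forall y, B y -> f (h y) = y)].

Definition closed_surface (R : realType) (S : topologicalType) : Prop :=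
  [/\ [set: S] !=set0, compact [set: S], connected [set: S], hausdorff_space S &
      forall x : S, exists (U : set S) (W : set 'rV[R]_2),
        [/\ open U, U x, open W & homeomorphic U W]].

(* The Euler genus is 2 - chi, with chi = #vertices - #edges + #triangles computed on
   a triangulation of S.  The conditions of [combinatorial_surface] hold for every
   finite triangulation of a closed surface. *)
Definition Euler_genus (R : realType) (S : topologicalType) (g : nat) : Prop :=
  exists (m : nat) (F : {set {set 'I_m}}),
    [/\ combinatorial_surface F,
        homeomorphic [set: S] (@realization R m F) &
        (m + #|F| + g = #|triangulation_edges F| + 2)%N].

(* Vertices are sent to distinct points by [p] and each edge d, as a two-element set
   of vertices, to the arc [gamma d] joining the images of its ends; an arc meets no
   vertex and no other arc in its interior.  The embedding need not be cellular. *)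
Definition embedding (R : realType) (S : topologicalType) (V : finType) (e : rel V)
    (p : V -> S) (gamma : {set V} -> R -> S) : Prop :=
  [/\ injective p,
      forall x y, e x y -> let c := gamma [set x; y]%SET in
        [/\ {within `[0, 1], continuous c},
            {in `[0, 1] &, injective c} &
            [set c 0; c 1] = [set p x; p y]],
      forall d v t, d \in edges e -> t \in `]0, 1[ -> gamma d t <> p v &
      forall d d' t t', d \in edges e -> d' \in edges e ->
        t \in `]0, 1[ -> t' \in `]0, 1[ -> gamma d t = gamma d' t' -> d = d'].

(* Main.v *)
(** Identify the colors with the field of k elements.  The colorings of a labeling (D, sigma)
    are the nonzeros of the product over the arcs (u, v) of x_v - sigma(x_u).  A permutation of
    the field is a polynomial of degree at most k - 2, and after a change of colors at the
    vertices the arcs of a set T that spans the components of G become trivial, hence of degree 1.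
    By Alon and Furedi's theorem the number N of colorings satisfies
    N^(k-1) >= k^(n(k-1) - |T| - (k-2)(|E| - |T|)), so it remains to bound |E|.

    Let r <= min(|T|, n) be the rank of the graph.  Then 3|E| <= 5(r + g): on a fine triangular
    grid the embedded graph is a minor of the 1-skeleton, because the lattice points around
    disjoint connected compact sets form disjoint connected sets.  In the minor the triangles
    become cycles of G that cover every edge at most twice, so their number is at most 2|E|/5,
    and the functions on E orthogonal to these cycles are coboundaries of G up to H^1(S; F_2),
    whose dimension is at most g by the Euler characteristic. *)
Require Import Defs.
From HB Require Import structures.
From mathcomp Require Import all_boot all_order all_algebra all_fingroup all_field.
From mathcomp Require Import all_classical all_reals all_analysis.
From mathcomp Require Import zify ring lra.
Import numFieldNormedType.Exports.
Import Order.TTheory GRing.Theory Num.Theory.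
Set Implicit Arguments.
Unset Strict Implicit.
Unset Printing Implicit Defensive.
Local Open Scope ring_scope.

(** * Nonzeros of polynomial functions over a finite field *)

(** The obstacle is that arcs are merely continuous and faces need not be discs, so neither a face
    count nor Euler's formula for the graph is at hand. Counting ['F_2]-valued functions takes their
    place: connectedness, cycles and cohomology are all expressed by such functions. Topological
    connectedness then enters only through locally constant functions, and compactness only to keep
    disjoint pieces apart on a fine grid. Dimensions appear as cardinalities that are powers of 2,
    and maps of quotients as injections between products of finite sets. Origin of 5/3: if w cycles
    remain after the deletions, then 5w <= 2|E| by the girth, and |E| - w <= r + g by cohomology. In
    the exponent the extreme case is r = |T| = n, where it becomes (n - 5g)(k - 2)/3. The assumption
    k > 2 makes the sum of all field elements vanish, which lowers the degree of a permutation from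
    k - 1 to k - 2. *)

Lemma succ_exp_le (i k : nat) : (i <= k)%N -> (k.+1 ^ i <= i.+1 * k ^ i)%N.
Proof.
elim: i => [//|i IH] ik; rewrite !expnS.
apply: leq_trans (leq_mul (leqnn _) (IH (ltnW ik))) _.
rewrite !mulnA leq_mul2r; apply/orP; right; nia.
Qed.

(** Taking roots, this says that x^(1/(x-1)) decreases. In the Alon-Furedi induction [j] is the
    number of parallel hyperplanes, out of [k], on which the polynomial survives. *)
Lemma exp_swap_le (j k : nat) : (0 < j <= k)%N -> (k ^ j.-1 <= j ^ k.-1)%N.
Proof.
case/andP=> j0 jk; rewrite -(subnKC jk); elim: (k - j)%N => [|i IH].
  by rewrite addn0.
rewrite addnS; have := @succ_exp_le j.-1 (j + i) ltac:(lia).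
have -> : (j + i).+1.-1 = (j + i).-1.+1 by lia.
rewrite (prednK j0) expnS => h; apply: leq_trans h _.
by rewrite leq_mul2l IH orbT.
Qed.

Section AlonFuredi.
Variables (V : finType) (F : finFieldType).
Implicit Types (f : {ffun V -> F} -> F) (x : {ffun V -> F}).

(* [poly_fun d f]: f is given by a polynomial of degree at most d. *)
Inductive poly_fun : nat -> ({ffun V -> F} -> F) -> Prop :=
| PolyConst d c f : f =1 (fun=> c) -> poly_fun d f
| PolyAdd d f1 f2 f : poly_fun d f1 -> poly_fun d f2 ->
    f =1 (fun x => f1 x + f2 x) -> poly_fun d f
| PolyMulX d v f1 f : poly_fun d f1 -> f =1 (fun x => x v * f1 x) ->
    poly_fun d.+1 f.

Lemma poly_fun_ext d f1 f2 : f1 =1 f2 -> poly_fun d f1 -> poly_fun d f2.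
Proof.
move=> e12 p; case: p e12 => {d f1} [d c f ef|d g1 g2 f p1 p2 ef|d v g f p ef] e12.
- by apply: (@PolyConst _ c) => x; rewrite -e12 ef.
- by apply: (PolyAdd p1 p2) => x; rewrite -e12 ef.
- by apply: (PolyMulX p) => x; rewrite -e12 ef.
Qed.

Lemma poly_fun_le d d' f : (d <= d')%N -> poly_fun d f -> poly_fun d' f.
Proof.
move=> dd' p; elim: p d' dd' => {d f}
  [d c f ef|d f1 f2 f _ IH1 _ IH2 ef|d v f1 f _ IH ef] d' dd'.
- exact: PolyConst ef.
- exact: (PolyAdd (IH1 _ dd') (IH2 _ dd')).
- by case: d' dd' => // d' dd'; exact: (PolyMulX (IH _ dd')).
Qed.

Lemma poly_funZ d c f : poly_fun d f -> poly_fun d (fun x => c * f x).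
Proof.
elim=> {d f} [d c' f ef|d f1 f2 f _ IH1 _ IH2 ef|d v f1 f _ IH ef].
- by apply: (@PolyConst _ (c * c')) => x; rewrite ef.
- by apply: (PolyAdd IH1 IH2) => x; rewrite ef mulrDr.
- by apply: (PolyMulX (v := v) IH) => x; rewrite ef mulrCA.
Qed.

Lemma poly_funM d d' f g : poly_fun d f -> poly_fun d' g ->
  poly_fun (d + d') (fun x => f x * g x).
Proof.
move=> pf pg; elim: pf => {d f} [d c f ef|d f1 f2 f _ IH1 _ IH2 ef|d v f1 f _ IH ef].
- apply: poly_fun_ext (poly_fun_le (leq_addl _ _) (poly_funZ c pg)) => x.
  by rewrite ef.
- by apply: (PolyAdd IH1 IH2) => x; rewrite ef mulrDl.
- by rewrite addSn; apply: (PolyMulX (v := v) IH) => x; rewrite ef mulrA.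
Qed.

Lemma poly_funX v : poly_fun 1 (fun x => x v).
Proof.
by apply: (@PolyMulX _ v (fun=> 1)) => [|x]; [exact: (@PolyConst _ 1)|rewrite mulr1].
Qed.

Lemma poly_funXn v i : poly_fun i (fun x => x v ^+ i).
Proof.
elim: i => [|i IH]; first exact: (@PolyConst _ 1).
by apply: (PolyMulX (v := v) IH) => x; rewrite exprS.
Qed.

Lemma poly_fun_sum (I : Type) (s : seq I) d (G : I -> {ffun V -> F} -> F) :
  (forall i, poly_fun d (G i)) -> poly_fun d (fun x => \sum_(i <- s) G i x).
Proof.
move=> pG; elim: s => [|i s IH].
  by apply: (@PolyConst _ 0) => x; rewrite big_nil.
by apply: (PolyAdd (pG i) IH) => x; rewrite big_cons.
Qed.

Lemma poly_fun_prod (I : eqType) (s : seq I) (dg : I -> nat)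
    (G : I -> {ffun V -> F} -> F) :
  {in s, forall i, poly_fun (dg i) (G i)} ->
  poly_fun (\sum_(i <- s) dg i) (fun x => \prod_(i <- s) G i x).
Proof.
elim: s => [|i s IH] pG.
  by apply: (@PolyConst _ 1) => x; rewrite big_nil.
have pGs : {in s, forall j, poly_fun (dg j) (G j)}.
  by move=> j js; apply: pG; rewrite inE js orbT.
rewrite big_cons.
apply: poly_fun_ext (poly_funM (pG i (mem_head _ _)) (IH pGs)) => x.
by rewrite big_cons.
Qed.

Definition set_at x y z : {ffun V -> F} := [ffun v => if v == y then z else x v].

Lemma set_at_id x y z : x y = z -> set_at x y z = x.
Proof. by move=> xy; apply/ffunP => v; rewrite ffunE; case: eqP => // ->. Qed.

Lemma set_at_set x y z z' : set_at (set_at x y z) y z' = set_at x y z'.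
Proof. by apply/ffunP => v; rewrite !ffunE; case: eqP. Qed.

Lemma poly_fun_set_at d f y z : poly_fun d f -> poly_fun d (fun x => f (set_at x y z)).
Proof.
elim=> {d f} [d c f ef|d f1 f2 f _ IH1 _ IH2 ef|d v f1 f _ IH ef].
- by apply: (@PolyConst _ c) => x; rewrite ef.
- by apply: (PolyAdd IH1 IH2) => x; rewrite ef.
- case: (eqVneq v y) => [vy|vy].
    apply: poly_fun_ext (poly_fun_le (leqnSn d) (poly_funZ z IH)) => x.
    by rewrite ef ffunE vy eqxx.
  by apply: (PolyMulX (v := v) IH) => x; rewrite ef ffunE (negbTE vy).
Qed.

(** Division by x_y - z, with the restriction to the hyperplane as remainder. A function does not
    determine a polynomial, so the quotient is built along the derivation of [poly_fun]. In degree 0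
    it vanishes, which later bounds the number of linear factors by the degree. *)
Lemma poly_fun_divX d f y z : poly_fun d f ->
  exists2 g, (forall x, f x = (x y - z) * g x + f (set_at x y z)) &
    if d is d'.+1 then poly_fun d' g else g =1 (fun=> 0).
Proof.
elim=> {d f} [d c f ef|d f1 f2 f _ [g1 e1 p1] _ [g2 e2 p2] ef|d v f1 f pf1 [g eg pg] ef].
- exists (fun=> 0) => [x|]; first by rewrite !ef mulr0 add0r.
  by case: d => // d; exact: (@PolyConst _ 0).
- exists (fun x => g1 x + g2 x) => [x|].
    by rewrite !ef [f1 x]e1 [f2 x]e2; ring.
  case: d p1 p2 => [p1 p2 x|d p1 p2]; first by rewrite p1 p2 addr0.
  exact: (PolyAdd p1 p2).
- case: (eqVneq v y) => [vy|vy].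
    (* With f1' the restriction of f1, x_y f1 - z f1' = (x_y - z) f1 + z (f1 - f1'). *)
    exists (fun x => f1 x + z * g x) => [x|].
      rewrite !ef ffunE vy eqxx.
      by rewrite [f1 x in LHS]eg [f1 x in RHS]eg; ring.
    case: d pf1 pg => [|d] pf1 pg.
      by apply: poly_fun_ext pf1 => x; rewrite pg mulr0 addr0.
    apply: (PolyAdd pf1) => //.
    by apply: poly_fun_le (leqnSn d) _; apply: poly_funZ; apply: pg.
  exists (fun x => x v * g x) => [x|].
    by rewrite !ef ffunE (negbTE vy) [f1 x in LHS]eg; ring.
  case: d pf1 pg => [|d] pf1 pg.
    by apply: (@PolyConst _ 0) => x; rewrite pg mulr0.
  exact: (PolyMulX pg).
Qed.

Lemma poly_fun_factor d f y (s : seq F) : poly_fun d f -> uniq s ->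
    {in s, forall z x, f (set_at x y z) = 0} -> (exists x, f x != 0) ->
  exists2 g, (size s <= d)%N /\ poly_fun (d - size s) g &
    forall x, f x = \prod_(z <- s) (x y - z) * g x.
Proof.
move=> pf us zs [x0 fx0]; elim: s us zs => [_ _|z s IH /= /andP[zNs us] zs].
  by exists f => [|x]; rewrite ?subn0 // big_nil mul1r.
have [|g [sd pg] eg] := IH us; first by move=> w ws; apply: zs; rewrite inE ws orbT.
(* At x_y = z the factors already extracted are nonzero, because the list has no duplicates; so the
   vanishing of [f] passes to [g]. *)
have gz x : g (set_at x y z) = 0.
  have := zs z (mem_head _ _) x; rewrite eg => /eqP; rewrite mulf_eq0.
  case/orP => [|/eqP//]; rewrite prodf_seq_eq0 => /hasP[w ws /=].
  by rewrite ffunE eqxx subr_eq0 => /eqP zw; rewrite zw ws in zNs.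
have [g' eg' pg'] := poly_fun_divX y z pg.
have eg2 x : g x = (x y - z) * g' x by rewrite eg' gz addr0.
exists g' => [|x]; last by rewrite eg eg2 big_cons; ring.
case dE: (d - size s)%N pg' => [|d'] pg'.
  by move: fx0; rewrite eg eg2 pg' !mulr0 eqxx.
have -> : (d - (size s).+1 = d')%N by lia.
by split => //; lia.
Qed.

Definition num_nonzero f : nat := #|[set x | f x != 0]|.

Lemma num_nonzero_set_at f y :
  (#|F| * num_nonzero f = \sum_z num_nonzero (fun x => f (set_at x y z)))%N.
Proof.
have nE f' : num_nonzero f' = (\sum_x (f' x != 0%R))%N.
  rewrite /num_nonzero -sum1_card big_mkcond /=.
  by apply: eq_bigr => x _; rewrite inE; case: (_ != _).
under eq_bigr do rewrite nE.
rewrite nE exchange_big /= big_distrr /=.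
under [LHS]eq_bigr => x _ do rewrite -sum_nat_const.
rewrite pair_big [RHS]pair_big /=.
(* [h] exchanges the coordinate [y] of the point with the extra field element; it matches the pairs
   counted on the two sides. *)
pose h (p : {ffun V -> F} * F) := (set_at p.1 y p.2, p.1 y).
have hh : involutive h.
  move=> [x z]; rewrite /h /= set_at_set ffunE eqxx set_at_id //.
by rewrite [RHS](reindex_inj (inv_inj hh)) /=; apply: eq_bigr => -[x z] _; rewrite /h /= set_at_set set_at_id.
Qed.

(* Weak form of the Alon-Furedi theorem, by induction on the set of variables
   that f involves: if f vanishes on s of the hyperplanes x_y = z, then it is the
   product of their equations and a function of degree d - s. *)
Lemma alon_furedi d f : poly_fun d f -> (exists x, f x != 0) ->
  (#|F| ^ (#|V| * #|F|.-1) <= num_nonzero f ^ #|F|.-1 * #|F| ^ d)%N.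
Proof.
have F0 : (0 < #|F|)%N by apply/card_gt0P; exists 0.
(* Only the set [U] of relevant variables shrinks. Nonzeros are always counted in the full space,
   which keeps the exponent [#|V|] fixed. *)
suff H (U : {set V}) : forall d f, poly_fun d f -> (exists x, f x != 0) ->
    (forall x x', {in U, x =1 x'} -> f x = f x') ->
    (#|F| ^ (#|V| * #|F|.-1) <= num_nonzero f ^ #|F|.-1 * #|F| ^ d)%N.
  move=> pf nf; apply: (H [set: V]) => // x x' xx'; congr f.
  by apply/ffunP => v; apply: xx'; rewrite inE.
have [u uE] := ubnP #|U|; elim: u U uE {d f} => // u IH U /ltnSE uE d f pf [x0 fx0] fU.
have [U0|[y yU]] := set_0Vmem U.
  have -> : num_nonzero f = (#|F| ^ #|V|)%N.
    rewrite /num_nonzero -card_ffun -cardsT; congr #|pred_of_set _|.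
    apply/setP => x; rewrite !inE (fU x x0) // => v; by rewrite U0 inE.
  by rewrite -expnM leq_pmulr // expn_gt0 F0.
pose Z := [set z | [forall x, f (set_at x y z) == 0]].
have Zs : {in enum Z, forall z x, f (set_at x y z) = 0}.
  by move=> z; rewrite mem_enum inE => /forallP H x; apply/eqP.
have [g [sd pg] fg] := poly_fun_factor pf (enum_uniq Z) Zs (ex_intro _ x0 fx0).
rewrite -cardE in sd pg.
have ZNT z : z \notin Z -> exists x, f (set_at x y z) != 0.
  by rewrite inE negb_forall => /existsP.
have x0Z : x0 y \notin Z.
  rewrite inE negb_forall; apply/existsP; exists x0.
  by rewrite set_at_id.
have nzE z : z \notin Z ->
    num_nonzero (fun x => f (set_at x y z)) = num_nonzero (fun x => g (set_at x y z)).
  move=> zZ; congr #|pred_of_set _|; apply/setP => x; rewrite !inE fg mulf_eq0 negb_or.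
  rewrite prodf_seq_neq0; case: allP => //= -[] w; rewrite mem_enum ffunE eqxx => wZ.
  by rewrite subr_eq0; apply: contraNneq zZ => ->.
have IHg z : z \notin Z -> (#|F| ^ (#|V| * #|F|.-1) <=
    num_nonzero (fun x => f (set_at x y z)) ^ #|F|.-1 * #|F| ^ (d - #|Z|))%N.
  move=> zZ; rewrite nzE //; apply: (IH (U :\ y)).
  - by rewrite (leq_trans _ uE) // (cardsD1 y U) yU.
  - exact: poly_fun_set_at.
  - have [x] := ZNT z zZ; rewrite fg mulf_eq0 negb_or => /andP[_ ?].
    by exists x.
  - move=> x x' xx'.
    have e : f (set_at x y z) = f (set_at x' y z).
      apply: fU => v vU; rewrite !ffunE; case: eqP => // /eqP vy.
      by apply: xx'; rewrite !inE vy.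
    have nz : \prod_(w <- enum Z) (z - w) != 0.
      rewrite prodf_seq_neq0; apply/allP => w; rewrite mem_enum => wZ /=.
      by rewrite subr_eq0; apply: contraNneq zZ => ->.
    move: e; rewrite !fg !ffunE eqxx; exact: mulfI.
(* By minimality each of the [#|~: Z|] hyperplanes where [f] survives carries at least [M]
   nonzeros. *)
pose zm := [arg min_(z < x0 y | z \notin Z) num_nonzero (fun x => f (set_at x y z))].
have [zmZ zmin] : zm \notin Z /\ (forall z, z \notin Z ->
   num_nonzero (fun x => f (set_at x y zm)) <= num_nonzero (fun x => f (set_at x y z)))%N.
  by rewrite /zm; case: arg_minnP.
set M := num_nonzero (fun x => f (set_at x y zm)) in zmin.
have ZF : (#|Z| + #|~: Z| = #|F|)%N by rewrite cardsC.
have kN : (#|~: Z| * M <= #|F| * num_nonzero f)%N.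
  rewrite (num_nonzero_set_at f y) (bigID (mem Z)) /= -sum_nat_const.
  apply: leq_trans (leq_addl _ _); rewrite [leqRHS](eq_bigl (mem (~: Z))); last first.
    by move=> z; rewrite !inE.
  by apply: leq_sum => z; rewrite inE => zZ; apply: zmin.
have Z0 : (0 < #|~: Z|)%N by apply/card_gt0P; exists zm; rewrite inE.
have ex : (#|F| ^ #|~: Z|.-1 <= #|~: Z| ^ #|F|.-1)%N.
  by apply: exp_swap_le; rewrite Z0 max_card.
have k1 : (0 < #|F| ^ #|F|.-1)%N by rewrite expn_gt0 F0.
rewrite -(leq_pmul2l k1) mulnA -expnMn.
have kNe : ((#|~: Z| * M) ^ #|F|.-1 <= (#|F| * num_nonzero f) ^ #|F|.-1)%N.
  by case: (#|F|.-1)%N => // e; rewrite leq_exp2r.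
apply: leq_trans (leq_mul kNe (leqnn _)).
have -> : d = (#|Z| + (d - #|Z|))%N by lia.
rewrite expnD expnMn.
(* Of the exponent |F| - 1, the part [#|~: Z|.-1] is paid for by [exp_swap_le] and the part [#|Z|]
   by the drop of the degree. *)
have -> : #|F|.-1 = (#|~: Z|.-1 + #|Z|)%N by lia.
move: (IHg zm zmZ) ex; rewrite -/M.
have <- : #|F|.-1 = (#|~: Z|.-1 + #|Z|)%N by lia.
have -> : (#|F| ^ #|F|.-1 = #|F| ^ #|~: Z|.-1 * #|F| ^ #|Z|)%N by rewrite -expnD; congr (_ ^ _)%N; lia.
set a := (#|F| ^ _)%N; set b := (M ^ _)%N; set c := (#|F| ^ _)%N => h1 h2.
rewrite -!mulnA.
apply: (@leq_trans (#|F| ^ #|~: Z|.-1 * (#|F| ^ #|Z| * (b * c)))%N).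
  by rewrite !leq_mul2l h1 !orbT.
rewrite [X in (_ <= X)%N](_ : _ = (#|~: Z| ^ #|F|.-1 * (#|F| ^ #|Z| * (b * c)))%N).
  by rewrite leq_mul2r h2 orbT.
by ring.
Qed.
End AlonFuredi.

(** * Gauges of a labeling *)

(** Multiplication by some c other than 0 and 1 permutes the field, so the sum equals c times
    itself. Over ['F_2] there is no such c, and the sum is 1. *)
Lemma finField_sum0 (F : finFieldType) : (2 < #|F|)%N -> \sum_(w : F) w = 0.
Proof.
move=> F2; have [c c0 c1] : exists2 c : F, c != 0 & c != 1.
  have : (0 < #|~: [set (0%R : F); 1%R]%SET|)%N.
    have := cardsC [set (0%R : F); 1%R]%SET; rewrite cards2 eq_sym oner_eq0 /= => cF.
    by move: F2; rewrite -cF !addSn !ltnS add0n.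
  by case/card_gt0P => c; rewrite !inE negb_or => /andP[]; exists c.
have : \sum_(w : F) w = c * \sum_(w : F) w.
  by rewrite mulr_sumr [LHS](reindex_inj (mulfI c0)).
move/eqP; rewrite -subr_eq0 -{1}[\sum_(w : F) w]mul1r -mulrBl mulf_eq0.
by rewrite subr_eq0 eq_sym (negbTE c1) => /eqP.
Qed.

Lemma finField_indicator (F : finFieldType) (z w : F) :
  1 - (z - w) ^+ #|F|.-1 = (z == w)%:R.
Proof.
have F1 := finNzRing_gt1 F; rewrite -subr_eq0.
have [->|nz] := eqVneq (z - w) 0.
  rewrite expr0n; case: #|F| F1 => [|[|c]] //= _; by rewrite subr0.
suff -> : (z - w) ^+ #|F|.-1 = 1 by rewrite subrr.
apply: (mulfI nz); rewrite mulr1 -exprS prednK ?expf_card //; exact: ltnW.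
Qed.

(* In Lagrange's formula the coefficient of degree |F| - 1 is the sum of all values
   of the permutation s, hence vanishes. *)
Lemma poly_fun_perm (V : finType) (F : finFieldType) (u : V) (s : F -> F) :
  (2 < #|F|)%N -> injective s -> poly_fun (#|F| - 2) (fun x : {ffun V -> F} => s (x u)).
Proof.
move=> F2 inj_s; have sum_s : \sum_w s w = 0.
  by have := finField_sum0 F2; rewrite (reindex_inj inj_s).
(* This is (z - w)^(|F| - 1) without its leading term, hence of degree at most |F| - 2 in z. *)
pose rest (w z : F) := \sum_(i < #|F|.-1) ((-1) ^+ i.+1 * (z ^+ (#|F|.-1 - i.+1) * w ^+ i.+1))
   *+ 'C(#|F|.-1, i.+1).
have restE w z : (z - w) ^+ #|F|.-1 = z ^+ #|F|.-1 + rest w z.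
  rewrite exprBn big_ord_recl /= subn0 !expr0 mul1r mulr1 bin0; congr (_ + _).
  by apply: eq_bigr => i _; rewrite /= /bump /= add1n mulrA.
have sE z : s z = \sum_w (- s w) * rest w z.
  transitivity (\sum_w s w * (z == w)%:R).
    rewrite (bigD1 z) //= eqxx mulr1 big1 ?addr0 // => w wz.
    by rewrite eq_sym (negbTE wz) mulr0.
  have -> : \sum_w s w * (z == w)%:R =
     (1 - z ^+ #|F|.-1) * \sum_w s w + \sum_w (- s w) * rest w z.
    rewrite mulr_sumr -big_split /=; apply: eq_bigr => w _.
    by rewrite -finField_indicator restE; ring.
  by rewrite sum_s mulr0 add0r.
apply: poly_fun_ext (fun x => esym (sE _)) _.
apply: poly_fun_sum => w; apply: poly_funZ; apply: poly_fun_sum => i.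
apply: (@poly_fun_le _ _ (#|F|.-1 - i.+1)); first by lia.
have e (x : {ffun V -> F}) : ((-1) ^+ i.+1 * w ^+ i.+1 *+ 'C(#|F|.-1, i.+1)) *
    x u ^+ (#|F|.-1 - i.+1) =
    ((-1) ^+ i.+1 * (x u ^+ (#|F|.-1 - i.+1) * w ^+ i.+1)) *+ 'C(#|F|.-1, i.+1).
  by rewrite mulrnAl; congr (_ *+ _); ring.
apply: (poly_fun_ext e); apply: poly_funZ; exact: poly_funXn.
Qed.

Section Gauge.
Variables (V A : finType) (L : labeling V A).
Implicit Types (tau : {ffun V -> {perm A}}).

(* Recoloring each vertex v by tau v replaces the permutation of the arc (u, v) by
   tau u * L.2 (u, v) * (tau v)^-1. *)
Definition trivialized tau : {set V * V} :=
  [set a in L.1 | (tau a.1 * L.2 a == tau a.2)%g].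

(* Maximize the number of trivialized arcs: if eta separated the ends of an arc, one
   could change tau by a common factor on a level set of eta and trivialize it too. *)
Lemma ex_spanning_trivialized : exists tau, forall eta : V -> 'F_2,
  {in trivialized tau, forall a, eta a.1 = eta a.2} ->
  {in L.1, forall a, eta a.1 = eta a.2}.
Proof.
pose tau := [arg max_(t > ([ffun=> 1%g] : {ffun V -> {perm A}})) #|trivialized t|].
have tauM t : (#|trivialized t| <= #|trivialized tau|)%N.
  by rewrite /tau; case: arg_maxnP => // t' _; apply.
exists tau => eta eta_triv a0 a0D; apply/eqP/negPn/negP => eta_a0.
(* Left multiplication by [pi] on the level set of [a0.1] makes [a0] trivial. A trivialized arc has
   both ends in this level set or neither, and so stays trivial. *)
pose pi := (tau a0.2 * (L.2 a0)^-1 * (tau a0.1)^-1)%g.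
pose tau' := [ffun u => if eta u == eta a0.1 then (pi * tau u)%g else tau u].
have := tauM tau'; rewrite leqNgt => /negP[]; apply: proper_card.
apply/properP; split.
  apply/fintype.subsetP => a aT; have := aT; rewrite !inE => /andP[-> /eqP ta] /=.
  have ea := eta_triv _ aT.
  by rewrite !ffunE -ea; case: ifP => _; rewrite -?mulgA ta.
exists a0; last first.
  by apply/negP => /eta_triv e0; rewrite e0 eqxx in eta_a0.
by rewrite inE a0D /= !ffunE eqxx (eq_sym (eta a0.2)) (negbTE eta_a0) /pi !mulgKV.
Qed.

Lemma num_colorings_ge tau :
  (exists q r : nat, [/\ prime q, (0 < r)%N & #|A| = (q ^ r)%N]) -> (2 < #|A|)%N ->
  (exists c, proper_coloring L c) ->
  (#|A| ^ (#|V| * #|A|.-1) <= num_colorings L ^ #|A|.-1 *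
     #|A| ^ (#|trivialized tau| + #|L.1 :\: trivialized tau| * (#|A| - 2)))%N.
Proof.
case=> q [r [pr_q r0 Aq]] A2 [c0 c0P].
have [F charF FA] := PrimePowerField pr_q r0.
have {}FA : #|F| = #|A| by rewrite FA Aq.
pose phi (a : A) : F := enum_val (cast_ord (esym FA) (enum_rank a)).
pose psi (z : F) : A := enum_val (cast_ord FA (enum_rank z)).
have phiK : cancel phi psi.
  by move=> a; rewrite /phi /psi enum_valK cast_ordKV enum_rankK.
have psiK : cancel psi phi.
  by move=> a; rewrite /phi /psi enum_valK cast_ordK enum_rankK.
(* The permutation of [a] in the new colors, carried over to the field. On a trivialized arc it is
   the identity, and the factor [G a] is linear. *)
pose s a z := phi ((tau a.2)^-1%g (L.2 a (tau a.1 (psi z)))).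
have inj_s a : injective (s a).
  by move=> z z' /(can_inj phiK) /perm_inj /perm_inj /perm_inj /(can_inj psiK).
pose G (a : V * V) (x : {ffun V -> F}) := x a.2 - s a (x a.1).
pose dg a := (if a \in trivialized tau then 1 else #|A| - 2)%N.
have pG : {in enum L.1, forall a, poly_fun (dg a) (G a)}.
  move=> a aD; rewrite /dg; case: ifP => aT.
    have sid z : s a z = z.
      move: aT; rewrite inE => /andP[_ /eqP e].
      by rewrite /s -[L.2 a _]permM e permK psiK.
    apply: (PolyAdd (poly_funX _ a.2) (poly_funZ (-1) (poly_funX _ a.1))) => x.
    by rewrite /G sid mulN1r.
  rewrite -FA; apply: PolyAdd (fun x => erefl _).
    by apply: poly_fun_le (poly_funX _ _); lia.
  apply: poly_fun_ext (poly_funZ (-1) (poly_fun_perm a.1 _ (inj_s a))) => [x|].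
    by rewrite mulN1r.
  by rewrite FA.
pose col (x : {ffun V -> F}) := [ffun v => tau v (psi (x v))].
pose loc (c : {ffun V -> A}) := [ffun v => phi ((tau v)^-1%g (c v))].
have colK : cancel col loc by move=> x; apply/ffunP => v; rewrite !ffunE permK psiK.
have locK : cancel loc col by move=> x; apply/ffunP => v; rewrite !ffunE phiK permKV.
have GE x : (\prod_(a <- enum L.1) G a x != 0) = proper_coloring L (col x).
  rewrite prodf_seq_neq0 /proper_coloring.
  apply/allP/forall_inP => H a aD.
    have := H a; rewrite mem_enum => /(_ aD); apply: contraNneq.
    rewrite !ffunE => e; rewrite /G /s e permK psiK.
    by rewrite subrr.
  have := H a; rewrite mem_enum in aD; move=> /(_ aD); apply: contraNneq.
  rewrite !ffunE => /eqP; rewrite subr_eq0 => /eqP e.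
  by rewrite e /s phiK permKV.
have := alon_furedi (poly_fun_prod pG); rewrite FA.
have -> : num_nonzero (fun x => \prod_(a <- enum L.1) G a x) = num_colorings L.
  rewrite /num_nonzero /num_colorings.
  rewrite -(card_imset _ (can_inj colK)); congr #|pred_of_set _|.
  apply/setP => c; rewrite inE; apply/imsetP/idP => [[x]|cP].
    by rewrite inE GE => ? ->.
  by exists (loc c); rewrite ?inE ?GE locK.
have -> : (\sum_(a <- enum L.1) dg a)%N =
   (#|trivialized tau| + #|L.1 :\: trivialized tau| * (#|A| - 2))%N.
  rewrite big_enum /= (bigID (mem (trivialized tau))) /=; congr addn.
    rewrite -sum1_card; apply: eq_big => [a|a /andP[_ aT]].
      by rewrite inE; case: (a \in L.1).
    by rewrite /dg aT.
  rewrite -sum_nat_const; apply: eq_big => [a|a /andP[_ aT]].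
    by rewrite [in RHS]inE andbC.
  by rewrite /dg (negbTE aT).
by apply; exists (loc c0); rewrite GE locK.
Qed.
End Gauge.

(** * Cycles in even subgraphs *)

Section EvenSubgraph.
Variables (V : finType) (h : rel V).
Hypotheses (h_sym : symmetric h) (h_irr : irreflexive h).

(* A longest path closes up at its first vertex. *)
Lemma ex_ucycle (x0 y0 : V) : h x0 y0 ->
  (forall v w, h v w -> exists2 w', h v w' & w' != w) ->
  exists2 s, (2 < size s)%N & ucycle h s.
Proof.
move=> hxy deg2.
pose P n := [exists s : n.-tuple V, uniq s && sorted h s].
have exP : exists n, P n.
  exists 2; apply/existsP; exists [tuple x0; y0] => /=.
  rewrite inE andbT hxy !andbT.
  by apply/eqP => xy; move: hxy; rewrite xy h_irr.
have leP n : P n -> (n <= #|V|)%N.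
  case/existsP => s /andP[us _]; rewrite -(size_tuple s) -(card_uniqP us).
  exact: max_card.
case: (ex_maxnP exP leP) => n /existsP[[s /= /eqP sn] /andP[us ss]] nmax.
have n2 : (2 <= n)%N.
  apply: nmax; apply/existsP; exists [tuple x0; y0] => /=.
  rewrite inE andbT hxy !andbT.
  by apply/eqP => xy; move: hxy; rewrite xy h_irr.
case: s sn us ss => [|x [|y s]] sn us ss; [by move: n2; rewrite -sn..|].
have hxy' : h x y by move: ss => /= /andP[].
(* Maximality puts the second neighbour [z] of [x] on the path; as [z] is not [y], the initial
   segment up to [z] closes to a cycle with at least 3 vertices. *)
have [z hxz zy] := deg2 _ _ hxy'.
have zx : z != x by apply: contraTneq hxz => ->; rewrite h_irr.
have zs : z \in s.
  apply/negPn/negP => zNs; suff : P n.+1 by move/nmax; rewrite ltnn.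
  apply/existsP; have sz : size [:: z, x, y & s] == n.+1 by rewrite /= -sn.
  exists (Tuple sz) => /=; rewrite (h_sym z) hxz; move: us ss => /= -> ->.
  by rewrite !inE (negbTE zx) (negbTE zy) (negbTE zNs).
case/splitPr: zs us ss {sn} => s1 s2 us ss.
exists [:: x, y & rcons s1 z]; first by rewrite /= size_rcons.
apply/andP; split.
  move: ss; rewrite -cat_rcons /= cat_path => /and3P[-> h1 _] /=.
  rewrite rcons_path last_rcons (h_sym z) hxz andbT.
  exact: h1.
move: us; rewrite -cat_rcons -[[:: x, y & _ ++ _]]/([:: x, y & rcons s1 z] ++ s2).
by rewrite cat_uniq => /andP[].
Qed.
End EvenSubgraph.

(** Even degrees leave no vertex of degree 1, so [H] contains a cycle, which has at least [l]
    vertices. Each of them has degree at least 2, and the degree sum 2|H| gives the bound. *)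
Lemma even_subgraph_card (V : finType) (e : rel V) (D H : {set V * V}) (l : nat) :
  symmetric e -> irreflexive e -> girth_ge e l -> is_orientation e D -> H \subset D ->
  H != finset.set0 ->
  (forall v, ~~ odd (#|[set a in H | a.1 == v]| + #|[set a in H | a.2 == v]|)) ->
  (l <= #|H|)%N.
Proof.
move=> e_sym e_irr girth oD HD H0 evenH.
pose h u v := ((u, v) \in H) || ((v, u) \in H).
have h_sym : symmetric h by move=> u v; rewrite /h orbC.
have oDxy x y := forallP (forallP oD x) y.
have De x y : (x, y) \in D -> e x y.
  by have := oDxy x y; case: (e x y) => // /negbTE ->.
have Dasym x y : (x, y) \in D -> (y, x) \notin D.
  by move=> xy; have := oDxy x y; rewrite De // xy.
have he u v : h u v -> e u v.
  case/orP => /(fintype.subsetP HD) uv; first exact: De.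
  by rewrite e_sym; apply: De.
have h_irr : irreflexive h by move=> x; apply/negP => /he; rewrite e_irr.
pose out v := [set a in H | a.1 == v]; pose inn v := [set a in H | a.2 == v].
have outin v : [disjoint out v & inn v].
  rewrite disjoint_subset; apply/fintype.subsetP => -[a b]; rewrite !inE /=.
  case/andP => aH /eqP av; rewrite aH /=; apply/eqP => bv.
  by have := h_irr v; rewrite /h -{1}av -bv aH.
have degU v : (#|out v| + #|inn v| = #|out v :|: inn v|)%N.
  by rewrite cardsU disjoint_setI0 // cards0 subn0.
have deg2 v w : h v w -> exists2 w', h v w' & w' != w.
  move=> vw; have := evenH v; rewrite degU.
  have [a aE] : exists a, [/\ a \in out v :|: inn v & a = (v, w) \/ a = (w, v)].
    case/orP: vw => vw; [exists (v, w)|exists (w, v)]; split; rewrite ?inE ?vw ?eqxx ?orbT //;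
      [by left|by right].
  case: aE => aI aE; rewrite (cardsD1 a) aI /= negbK => od.
  have /card_gt0P[b] : (0 < #|(out v :|: inn v) :\ a|)%N by case: #|_| od.
  rewrite !inE => /andP[ba]; rewrite -andb_orr => /andP[bH bv].
  have b1 : b = (b.1, b.2) by case: b {ba bH bv}.
  have [bv1|bv2] := orP bv.
    exists b.2; first by rewrite /h -(eqP bv1) -b1 bH.
    apply: contra_neq ba => bw; rewrite b1 bw (eqP bv1).
    case: aE => // aE; move: bH (Dasym v w); rewrite b1 bw (eqP bv1) => /(fintype.subsetP HD) vwD /(_ vwD).
    have : a \in D by apply: (fintype.subsetP HD); move: aI; rewrite !inE -andb_orr => /andP[].
    by rewrite aE => ->.
  exists b.1; first by rewrite /h -(eqP bv2) -b1 bH orbT.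
  apply: contra_neq ba => bw; rewrite b1 bw (eqP bv2).
  case: aE => // aE; move: bH (Dasym w v); rewrite b1 bw (eqP bv2) => /(fintype.subsetP HD) vwD /(_ vwD).
  have : a \in D by apply: (fintype.subsetP HD); move: aI; rewrite !inE -andb_orr => /andP[].
  by rewrite aE => ->.
have [a0 a0H] := set0Pn _ H0.
have [] := @ex_ucycle _ h h_sym h_irr a0.1 a0.2 _ deg2.
  by rewrite /h -surjective_pairing a0H.
move=> s s3 /andP[cs us].
have ls : (l <= size s)%N.
  by apply: girth => //; rewrite /ucycle us andbT (sub_cycle _ cs).
apply: leq_trans ls _; rewrite -(card_uniqP us).
have deg_s v : v \in s -> (2 <= #|out v| + #|inn v|)%N.
  move=> vs; have := evenH v.
  have [w hw] : exists w, h v w by exists (next s v); exact: next_cycle.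
  have : (0 < #|out v| + #|inn v|)%N.
    rewrite degU; apply/card_gt0P.
    by case/orP: hw => vw; [exists (v, w)|exists (w, v)]; rewrite !inE vw eqxx ?orbT.
  by rewrite -/(out v) -/(inn v); case: (_ + _)%N => [|[|]].
have sumH (pr : V * V -> V) : (\sum_v #|[set a in H | pr a == v]| = #|H|)%N.
  rewrite -sum1_card (partition_big pr predT) //=; apply: eq_bigr => v _.
  by rewrite -sum1_card; apply: eq_bigl => a; rewrite !inE.
have : (\sum_(v in s) 2 <= \sum_v (#|out v| + #|inn v|))%N.
  rewrite [leqRHS](bigID (mem s)) /=; apply: leq_trans (leq_addr _ _).
  exact: leq_sum.
rewrite big_split /= !sumH sum_nat_const.
set x := #|_|; set y := #|_|; lia.
Qed.

(** * Linear algebra over the field with two elements *)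

Lemma F2_cases (z : 'F_2) : z = 0 \/ z = 1.
Proof. by case: z => [[|[|]]] // i; [left|right]; apply: val_inj. Qed.

Lemma addF2 (z : 'F_2) : z + z = 0.
Proof. by case: (F2_cases z) => ->; apply: val_inj. Qed.

Lemma addF2_eq0 (y z : 'F_2) : y + z = 0 -> y = z.
Proof. by case: (F2_cases y) => ->; case: (F2_cases z) => ->; rewrite ?addr0 ?add0r. Qed.

Lemma F2_neq0 (z : 'F_2) : z != 0 -> z = 1.
Proof. by case: (F2_cases z) => ->. Qed.

Lemma natrF2_eq0 (n : nat) : n%:R = 0 :> 'F_2 -> ~~ odd n.
Proof.
rewrite -{1}(odd_double_half n) natrD -mul2n natrM.
have -> : 2%:R = 0 :> 'F_2 by apply: val_inj.
by rewrite mul0r addr0; case: (odd n).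
Qed.

Definition dot (X : finType) (v f : {ffun X -> 'F_2}) : 'F_2 := \sum_x v x * f x.

Lemma dotDl (X : finType) (v w f : {ffun X -> 'F_2}) : dot (v + w) f = dot v f + dot w f.
Proof. by rewrite -big_split; apply: eq_bigr => x _; rewrite ffunE mulrDl. Qed.

Lemma dotBr (X : finType) (v w f : {ffun X -> 'F_2}) : dot f (v - w) = dot f v - dot f w.
Proof. by rewrite -sumrB; apply: eq_bigr => x _; rewrite !ffunE mulrBr. Qed.

Section Duality.

(** The nontrivial character of ['F_2]; its sums over all vectors detect the zero functional and
    stand in for rank computations. *)
Definition sgnF2 (z : 'F_2) : int := if z == 0 then 1 else -1.

Lemma sgnF2D : {morph sgnF2 : y z / y + z >-> y * z}.
Proof.
by move=> y z; case: (F2_cases y) => ->; case: (F2_cases z) => ->;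
   rewrite /sgnF2 ?addr0 ?add0r ?addF2.
Qed.

Lemma sum_sgnF2 (X : finType) (v : X -> 'F_2) :
  \sum_(x : {ffun X -> 'F_2}) sgnF2 (\sum_i x i * v i) =
  if [forall i, v i == 0] then (2 ^ #|X|)%N%:Z else 0.
Proof.
have sgn_sum (x : {ffun X -> 'F_2}) :
    sgnF2 (\sum_i x i * v i) = \prod_i sgnF2 (x i * v i).
  by rewrite (big_morph _ sgnF2D (_ : sgnF2 0 = 1)).
under eq_bigr do rewrite sgn_sum.
rewrite -(bigA_distr_bigA (fun i (b : 'F_2) => sgnF2 (b * v i))) /=.
have E i : \sum_(b : 'F_2) sgnF2 (b * v i) = if v i == 0 then 2%:Z else 0.
  rewrite (bigD1 0) //= (bigD1 1) //= big1 => [|b /andP[b0 b1]]; last first.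
    by case: (F2_cases b) b0 b1 => ->.
  by rewrite mul0r mul1r addr0 /sgnF2 eqxx; case: ifP.
under eq_bigr do rewrite E.
case: forallP => [v0|/forallP]; last first.
  by rewrite negb_forall => /existsP[i /negbTE vi]; rewrite (bigD1 i) //= vi mul0r.
under eq_bigr => i _ do rewrite v0.
rewrite prodr_const; elim: #|_| => // n IH.
by rewrite exprS IH expnS PoszM.
Qed.

(* Both sides are the sum over all x and y of the sign of the bilinear form. *)
Lemma card_kernel_duality (X Y : finType) (M : X -> Y -> 'F_2) :
  (#|[set y : {ffun Y -> 'F_2} | [forall i, (\sum_j M i j * y j == 0)%R]]| * 2 ^ #|X| =
   #|[set x : {ffun X -> 'F_2} | [forall j, (\sum_i x i * M i j == 0)%R]]| * 2 ^ #|Y|)%N.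
Proof.
apply/eqP; rewrite -eqz_nat !PoszM; apply/eqP.
transitivity (\sum_(y : {ffun Y -> 'F_2}) \sum_(x : {ffun X -> 'F_2})
    sgnF2 (\sum_i x i * \sum_j M i j * y j)).
  under eq_bigr do rewrite sum_sgnF2.
  rewrite -big_mkcond sumr_const -mulr_natl natz; congr (_%:Z * _).
  by rewrite cardsE.
rewrite exchange_big /=.
have swap (x : {ffun X -> 'F_2}) (y : {ffun Y -> 'F_2}) :
    \sum_i x i * (\sum_j M i j * y j) = \sum_j y j * \sum_i x i * M i j.
  under eq_bigr do rewrite big_distrr /=.
  rewrite exchange_big; apply: eq_bigr => j _; rewrite big_distrr.
  by apply: eq_bigr => i _ /=; ring.
under eq_bigr do under eq_bigr do rewrite swap.
under eq_bigr do rewrite sum_sgnF2.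
rewrite -big_mkcond sumr_const -mulr_natl natz; congr (_%:Z * _).
by rewrite cardsE.
Qed.

End Duality.

Section Deletion.
Variable X : finType.
Implicit Types (v f : {ffun X -> 'F_2}) (vs : seq {ffun X -> 'F_2}) (x : X).

Definition covers_twice vs := forall x, (count (fun v => v x != 0%R) vs <= 2)%N.

Definition add_at f x c : {ffun X -> 'F_2} := [ffun y => f y + (y == x)%:R * c].

Lemma dot_add_at v f x c : dot v (add_at f x c) = dot v f + v x * c.
Proof.
rewrite /dot; under eq_bigr do rewrite ffunE mulrDr.
rewrite big_split /= (bigD1 (P := xpredT) (F := fun i => v i * (_ * _)) x) //=.
by rewrite eqxx mul1r [X in _ + (_ + X)]big1 ?addr0 // => y /negbTE ->; rewrite mul0r mulr0.
Qed.

(* Two members that share the deleted coordinate are merged into their sum; this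
   amounts to removing an edge between two faces. *)
Lemma covers_twice_delete1 vs x : covers_twice vs -> exists vs',
  [/\ covers_twice vs',
      forall P : {ffun X -> 'F_2} -> Prop, (forall v w, P v -> P w -> P (v + w)) ->
        {in vs, forall v, P v} -> {in vs', forall v, P v},
      {in vs', forall v, v x = 0} &
      forall f, {in vs', forall v, dot v f = 0} -> exists2 f' : {ffun X -> 'F_2},
        forall y, y != x -> f' y = f y & {in vs, forall v, dot v f' = 0}].
Proof.
move=> vs2; pose on v := v x != 0.
have mem_off v : v \in seq.filter (predC on) vs -> v \in vs /\ v x = 0.
  by rewrite mem_filter /= /on negbK => /andP[/eqP].
have mem_split v : v \in vs -> v \in seq.filter on vs \/ v \in seq.filter (predC on) vs.
  by move=> vvs; rewrite !mem_filter /= vvs !andbT; case: (on v); [left|right].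
have cnt y : (count (fun v => v y != 0%R) vs = count (fun v => v y != 0%R) (seq.filter on vs) +
    count (fun v => v y != 0%R) (seq.filter (predC on) vs))%N.
  rewrite -count_cat.
  have /seq.permP e := permEl (perm_filterC on vs).
  exact: esym (e _).
have on2 : (size (seq.filter on vs) <= 2)%N by rewrite size_filter; exact: vs2.
have on1 v : v \in seq.filter on vs -> v x = 1.
  by rewrite mem_filter => /andP[/F2_neq0].
have onv v : v \in seq.filter on vs -> v \in vs by rewrite mem_filter => /andP[].
have off_keep f c v : v \in seq.filter (predC on) vs -> dot v (add_at f x c) = dot v f.
  by move=> /mem_off[_ vx]; rewrite dot_add_at vx mul0r addr0.
have add_keep f c y : y != x -> add_at f x c y = f y.
  by move=> yx; rewrite ffunE (negbTE yx) mul0r addr0.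
case onE: (seq.filter on vs) on2 => [|a [|b [|]]] // _.
- exists (seq.filter (predC on) vs); split.
  + by move=> y; have := vs2 y; rewrite cnt onE.
  + by move=> P _ Pvs v /mem_off[/Pvs].
  + by move=> v /mem_off[].
  + move=> f fvs; exists f => // v /mem_split[]; last exact: fvs.
    by rewrite onE.
- exists (seq.filter (predC on) vs); split.
  + move=> y; have := vs2 y; rewrite cnt => h; apply: leq_trans h; exact: leq_addl.
  + by move=> P _ Pvs v /mem_off[/Pvs].
  + by move=> v /mem_off[].
  (* Only [a] sees the coordinate [x], so a change of [f] there corrects [a] and nothing else. *)
  + move=> f fvs; exists (add_at f x (dot a f)); first exact: add_keep.
    move=> v /mem_split[|vo]; last by rewrite off_keep // fvs.
    rewrite onE inE => /eqP ->; rewrite dot_add_at on1 ?onE ?mem_head //.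
    by rewrite mul1r addF2.
- have [ax bx] : a x = 1 /\ b x = 1 by split; apply: on1; rewrite onE !inE eqxx ?orbT.
  exists ((a + b) :: seq.filter (predC on) vs); split.
  + move=> y; have := vs2 y; rewrite cnt onE /= ffunE => h; apply: leq_trans h.
    rewrite leq_add2r addn0; case: (F2_cases (a y)) => ->; case: (F2_cases (b y)) => -> //.
  + move=> P Padd Pvs v; rewrite inE => /predU1P[->|/mem_off[/Pvs]//].
    by apply: Padd; apply: Pvs; apply: onv; rewrite onE !inE eqxx ?orbT.
  + move=> v; rewrite inE => /predU1P[->|/mem_off[]//].
    by rewrite ffunE ax bx addF2.
  (* Orthogonality to a + b means that [a] and [b] need the same correction at [x]. *)
  + move=> f fvs; exists (add_at f x (dot a f)); first exact: add_keep.
    have abf : dot a f = dot b f.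
      by apply: addF2_eq0; rewrite -dotDl fvs ?mem_head.
    move=> v /mem_split[|vo]; last by rewrite off_keep // fvs // inE vo orbT.
    rewrite onE !inE => /orP[] /eqP ->; rewrite dot_add_at ?ax ?bx mul1r.
      by rewrite addF2.
    by rewrite abf addF2.
Qed.

(** The clause for additive properties [P] is used twice: here it keeps the coordinates already
    deleted at 0, and later it carries evenness from the triangles to the merged cycles. *)
Lemma covers_twice_delete vs (s : seq X) : covers_twice vs -> exists vs',
  [/\ covers_twice vs',
      forall P : {ffun X -> 'F_2} -> Prop, (forall v w, P v -> P w -> P (v + w)) ->
        {in vs, forall v, P v} -> {in vs', forall v, P v},
      {in vs' & s, forall v x, v x = 0} &
      forall f, {in vs', forall v, dot v f = 0} -> exists2 f' : {ffun X -> 'F_2},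
        forall y, y \notin s -> f' y = f y & {in vs, forall v, dot v f' = 0}].
Proof.
move=> vs2; elim: s => [|x s [vs1 [c1 P1 z1 e1]]].
  by exists vs; split => // f; exists f.
have [vs' [c' P' z' e']] := covers_twice_delete1 x c1.
exists vs'; split => //.
- by move=> P Padd Pvs; apply: P' => //; apply: P1.
- move=> v y vvs'; rewrite inE => /predU1P[->|ys]; first exact: z'.
  apply: (P' (fun v => v y = 0)) vvs'.
    by move=> v1 v2 e2 e3; rewrite ffunE e2 e3 addr0.
  by move=> w wvs; apply: z1.
- move=> f /e'[f1 f1f /e1[f2 f2f1 f2vs]]; exists f2 => // y.
  by rewrite inE negb_or => /andP[yx ys]; rewrite f2f1 // f1f.
Qed.

End Deletion.

(** * Minors of a triangulated surface *)

Lemma cards3 (W : finType) (a b c : W) :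
  a != b -> a != c -> b != c -> #|[set a; b; c]%SET| = 3.
Proof.
by move=> ab ac bc; rewrite finset.setUC cardsU1 cards2 !inE ab negb_or ![c == _]eq_sym ac bc.
Qed.

Lemma cards3E (W : finType) (s : {set W}) : #|s| = 3 ->
  exists a b c, [/\ a != b, a != c, b != c & s = [set a; b; c]%SET].
Proof.
move=> s3; have /card_gt0P[a aS] : (0 < #|s|)%N by rewrite s3.
have := cardsD1 a s; rewrite s3 aS add1n => /eqP; rewrite eqSS eq_sym => sa2.
have /cards2P[b [c [bc sE]]] := sa2.
have : b \in s :\ a by rewrite sE !inE eqxx.
have : c \in s :\ a by rewrite sE !inE eqxx orbT.
rewrite !inE => /andP[ca cs] /andP[ba bs].
exists a, b, c; split=> //; [by rewrite eq_sym|by rewrite eq_sym|].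
by rewrite -(finset.setD1K aS) sE finset.setUA.
Qed.

Lemma sum_subsets2 (W : finType) (M : zmodType) (a b c : W) (G : {set W} -> M) :
  a != b -> a != c -> b != c ->
  \sum_(x : {set W} | (x \subset [set a; b; c]%SET) && (#|x| == 2)) G x =
  G [set b; c]%SET + G [set a; c]%SET + G [set a; b]%SET.
Proof.
move=> ab ac bc; set s := [set a; b; c]%SET.
have s3 : #|s| = 3 by rewrite cards3 ?ab.
have sD z : z \in s -> #|s :\ z| = 2.
  by move=> zs; have := cardsD1 z s; rewrite zs s3 => -[].
rewrite (eq_bigl (mem [set s :\ z | z in s]%SET)); last first.
  move=> x; apply/andP/imsetP => [[xs /eqP x2]|[z zs ->]]; last first.
    by rewrite subsetDl sD.
  have : (0 < #|s :\: x|)%N.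
    have := cardsID x s; rewrite s3 (finset.setIidPr xs) x2; lia.
  case/card_gt0P => z; rewrite inE => /andP[zx zs]; exists z => //.
  apply/eqP; rewrite eqEcard sD // x2 leqnn andbT; apply/fintype.subsetP => y yx.
  rewrite !inE; apply/andP; split; first by apply: contraNneq zx => <-.
  by have := fintype.subsetP xs y yx; rewrite !inE.
rewrite big_imset /=; last first.
  move=> y z ys zs e; apply/eqP; apply/negPn/negP => yz.
  have : y \in s :\ z by rewrite !inE yz; move: ys; rewrite !inE.
  by rewrite -e !inE eqxx.
rewrite /s -finset.setUA big_setU1 ?inE ?negb_or ?ab ?ac //= big_setU1 ?inE //= big_set1 addrA.
have [ba ca cb] : [/\ b != a, c != a & c != b] by rewrite ![_ == a]eq_sym [c == b]eq_sym.
congr (G _ + (G _) + (G _)); apply/setP => y; rewrite !inE.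
- by case: (eqVneq y a) => [->|_] //=; rewrite (negbTE ab) (negbTE ac).
- by case: (eqVneq y b) => [->|_] //=; rewrite ?orbF // (negbTE ba) (negbTE bc).
- by case: (eqVneq y c) => [->|_] //=; rewrite ?orbF // (negbTE ca) (negbTE cb).
Qed.

(* Connectedness of the subgraph induced on X, through F_2-valued functions. *)
Definition conn (W : finType) (adj : rel W) (X : {set W}) : Prop :=
  forall eta : W -> 'F_2, {in X &, forall a b, adj a b -> eta a = eta b} ->
  {in X &, forall a b, eta a = eta b}.

Section Cochains.
Variables (W : finType) (tris : {set {set W}}).

Definition boundary (s : {set W}) : {ffun {set W} -> 'F_2} :=
  [ffun x : {set W} => ((x \subset s) && (#|x| == 2))%:R].

(* A 1-cochain is a function on all sets of vertices; only its values on the edges,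
   which are two-element sets, matter. *)
Definition closed_cochain (f : {ffun {set W} -> 'F_2}) : Prop :=
  {in tris, forall s, dot (boundary s) f = 0}.

Lemma dot_boundary (s : {set W}) f :
  dot (boundary s) f = \sum_(x : {set W} | (x \subset s) && (#|x| == 2)) f x.
Proof.
rewrite [RHS]big_mkcond; apply: eq_bigr => x _; rewrite ffunE.
by case: ifP => _; rewrite ?mul1r ?mul0r.
Qed.

Lemma closed_cochainB f g : closed_cochain f -> closed_cochain g -> closed_cochain (f - g).
Proof. by move=> cf cg s sT; rewrite dotBr cf // cg // subrr. Qed.

(** Orthogonality to all coboundaries, that is, being a cycle mod 2. Arbitrary [h] allows a test on
    the indicator of a whole branch set, as contraction requires. *)
Definition even_vec (v : {ffun {set W} -> 'F_2}) : Prop :=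
  forall h : W -> 'F_2, \sum_x v x * (\sum_(a in x) h a) = 0.

Lemma even_boundary (s : {set W}) : #|s| = 3 -> even_vec (boundary s).
Proof.
move=> /cards3E[a [b [c [ab ac bc ->]]]] h.
have -> : \sum_x boundary [set a; b; c]%SET x * (\sum_(y in x) h y) =
   \sum_(x : {set W} | (x \subset [set a; b; c]%SET) && (#|x| == 2)) \sum_(y in x) h y.
  rewrite [RHS]big_mkcond; apply: eq_bigr => x _; rewrite ffunE.
  by case: ifP => _; rewrite ?mul1r ?mul0r.
rewrite sum_subsets2 // !big_setU1 ?inE //= !big_set1.
by case: (F2_cases (h a)) => ->; case: (F2_cases (h b)) => ->;
   case: (F2_cases (h c)) => ->; apply: val_inj.
Qed.

Lemma even_vecD v w : even_vec v -> even_vec w -> even_vec (v + w).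
Proof.
move=> ev ew h; under eq_bigr do rewrite ffunE mulrDl.
by rewrite big_split /= ev ew addr0.
Qed.

End Cochains.

(** The number of its values is 2 to the rank of the graph; in this form the rank enters the edge
    bound. *)
Definition coboundary_on (V : finType) (D : {set V * V}) (eta : {ffun V -> 'F_2}) :
    {ffun {a : V * V | a \in D} -> 'F_2} :=
  [ffun a => eta (val a).1 + eta (val a).2].

Section Minor.
Variables (W : finType) (tris : {set {set W}}) (adj : rel W).
Hypothesis adj_irr : irreflexive adj.
Hypothesis tris3 : {in tris, forall s : {set W}, #|s| = 3}.
Hypothesis tris2 : forall x : {set W}, #|x| = 2 -> (#|[set s in tris | x \subset s]| <= 2)%N.

(** [Zs] and [Bs] stand for the closed and exact 1-cochains of the original triangulation, and [bar]
    for summing a cochain of the fine grid along the original edges. *)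
Variables (Y : finType) (g : nat) (Zs Bs : {set {ffun Y -> 'F_2}}).
Variable bar : {ffun {set W} -> 'F_2} -> {ffun Y -> 'F_2}.
Hypothesis barB : forall f1 f2, bar (f1 - f2) = bar f1 - bar f2.
Hypothesis barZ : forall f, closed_cochain tris f -> bar f \in Zs.
Hypothesis BsB : {in Bs &, forall y z, y - z \in Bs}.
Hypothesis ZsB : forall y z, y \in Zs -> z \in Bs -> y + z \in Zs.
Hypothesis Bs0 : 0 \in Bs.
Hypothesis card_Zs : (#|Zs| <= 2 ^ g * #|Bs|)%N.
Hypothesis exact_bar : forall f, closed_cochain tris f -> bar f \in Bs ->
  exists eta : W -> 'F_2, forall a b, adj a b -> f [set a; b]%SET = eta a + eta b.

Variables (V : finType) (e : rel V) (D : {set V * V}).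
Hypotheses (e_sym : symmetric e) (e_irr : irreflexive e) (girth5 : girth_ge e 5).
Hypothesis oD : is_orientation e D.

Variables (BS : V -> {set W}) (ed : V * V -> W * W).
Hypothesis BS_disj : forall u v, u != v -> [disjoint BS u & BS v].
Hypothesis BS_conn : forall v, conn adj (BS v).
Hypothesis ed_in : {in D, forall a, (ed a).1 \in BS a.1 /\ (ed a).2 \in BS a.2}.
Hypothesis ed_adj : {in D, forall a, adj (ed a).1 (ed a).2}.

Let ede (a : V * V) : {set W} := [set (ed a).1; (ed a).2]%SET.
Let E := {a : V * V | a \in D}.

Let Dneq a : a \in D -> a.1 != a.2.
Proof.
case: a => u v uvD; apply/eqP => /= uv; move: uvD; rewrite uv => vvD.
by have := forallP (forallP oD v) v; rewrite e_irr vvD.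
Qed.

Let BS_eq w u v : w \in BS u -> w \in BS v -> u = v.
Proof.
move=> wu wv; apply/eqP/negPn/negP => /BS_disj /disjointFr /(_ wu).
by rewrite wv.
Qed.

Let ede_neq a : a \in D -> (ed a).1 != (ed a).2.
Proof.
move=> aD; have [h1 h2] := ed_in aD; apply: contraNneq (Dneq aD) => h.
by apply/eqP; apply: BS_eq h1 _; rewrite h.
Qed.

Let ede_inj : {in D &, injective ede}.
Proof.
move=> a b aD bD eab; have [a1 a2] := ed_in aD; have [b1 b2] := ed_in bD.
have : (ed b).1 \in ede a by rewrite eab !inE eqxx.
have : (ed b).2 \in ede a by rewrite eab !inE eqxx orbT.
have nb := ede_neq bD; rewrite !inE => /orP[] /eqP e2 /orP[] /eqP e1;
  try by rewrite e1 e2 eqxx in nb.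
- have ab2 : a.1 = b.2 by apply: (BS_eq a1); rewrite -e2.
  have ab1 : a.2 = b.1 by apply: (BS_eq a2); rewrite -e1.
  have := forallP (forallP oD a.1) a.2.
  have -> : (a.2, a.1) = b by rewrite ab1 ab2 -surjective_pairing.
  by rewrite -surjective_pairing aD bD /=; case: (e _ _).
- have ab2 : a.2 = b.2 by apply: (BS_eq a2); rewrite -e2.
  have ab1 : a.1 = b.1 by apply: (BS_eq a1); rewrite -e1.
  by rewrite [a]surjective_pairing ab1 ab2 -surjective_pairing.
Qed.

Let inside (x : {set W}) :=
  [exists v, exists a in BS v, exists b in BS v, adj a b && (x == [set a; b]%SET)].
(** Edges inside a branch set are contracted, the chosen edges are kept, and everything else is
    deleted, including the sets that are not edges at all. *)
Let deleted := [seq x <- enum {set W} | ~~ inside x && (x \notin ede @: D)].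

Let insideN a : a \in D -> ~~ inside (ede a).
Proof.
move=> aD; apply/existsP => -[v /exists_inP[b bv /exists_inP[c cv /andP[_ /eqP ebc]]]].
have [a1 a2] := ed_in aD.
have sub w : w \in ede a -> w \in BS v by rewrite ebc !inE => /orP[] /eqP ->.
have := Dneq aD; rewrite (BS_eq a1 (sub _ _)) ?inE ?eqxx //.
by rewrite (BS_eq a2 (sub _ _)) ?inE ?eqxx ?orbT.
Qed.

Let extend (phi : {ffun E -> 'F_2}) : {ffun {set W} -> 'F_2} :=
  [ffun x => \sum_a (x == ede (val a))%:R * phi a].

Let extend_ede phi (a : E) : extend phi (ede (val a)) = phi a.
Proof.
rewrite ffunE (bigD1 a) //= eqxx mul1r big1 ?addr0 // => b ba.
case: eqP => [/ede_inj e_ab|]; last by rewrite mul0r.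
by have := e_ab (valP a) (valP b) => /val_inj h; rewrite h eqxx in ba.
Qed.

Let extend_inside phi x : inside x -> extend phi x = 0.
Proof.
move=> xi; rewrite ffunE big1 // => a _; case: eqP => [xa|]; last by rewrite mul0r.
by have := insideN (valP a); rewrite -xa xi.
Qed.

Let restr (v : {ffun {set W} -> 'F_2}) : {ffun E -> 'F_2} := [ffun a => v (ede (val a))].

Let dot_extend v phi : dot v (extend phi) = dot (restr v) phi.
Proof.
rewrite /dot; under eq_bigr do rewrite ffunE big_distrr /=.
rewrite exchange_big /=; apply: eq_bigr => a _; rewrite ffunE.
rewrite (bigD1 (ede (val a))) //= eqxx mul1r big1 ?addr0 // => x /negbTE ->.
by rewrite mul0r mulr0.
Qed.

(** Evenness is tested on the indicator of [BS u]: an edge inside a branch set has both or no ends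
    there and contributes 0. What remains is the parity of the degree of [u] in the subgraph where
    [v] is nonzero. *)
Let bs_even v : even_vec v -> {in deleted, forall x, v x = 0} -> restr v != 0 ->
  (5 <= #|[set a in D | v (ede a) != 0%R]|)%N.
Proof.
move=> ev vD vn0; apply: (even_subgraph_card e_sym e_irr girth5 oD).
- by apply/fintype.subsetP => a; rewrite inE => /andP[].
- apply: contra_neq vn0 => H0; apply/ffunP => a; rewrite !ffunE; apply/eqP/negPn/negP => va.
  by move/finset.setP: H0 => /(_ (val a)); rewrite !inE (valP a) va.
- move=> u; apply: natrF2_eq0.
  have := ev (fun w => (w \in BS u)%:R).
  rewrite (bigID (mem (ede @: D))) /= [X in _ + X]big1 ?addr0 => [|x xN]; last first.
    case: (boolP (inside x)) => [|xi]; last by rewrite vD ?mul0r // mem_filter mem_enum xi xN.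
    case/existsP => v' /exists_inP[b bv /exists_inP[c cv /andP[bca /eqP ->]]].
    have bc : b != c by apply/eqP => bc; rewrite bc adj_irr in bca.
    rewrite big_setU1 ?inE //= big_set1.
    have -> : (b \in BS u) = (c \in BS u).
      by apply/idP/idP => [/BS_eq/(_ bv) ->|/BS_eq/(_ cv) ->].
    by rewrite addF2 mulr0.
  rewrite big_imset //= => h; rewrite -{}[RHS]h.
  rewrite natrD -!sum1_card !natr_sum.
  rewrite !(big_mkcond (fun a => a \in [set _ in _ | _])) -big_split [RHS]big_mkcond /=.
  apply: eq_bigr => a _; rewrite !inE; case aD: (a \in D) => //=; last by rewrite addr0.
  have [a1 a2] := ed_in aD.
  rewrite big_setU1 ?inE ?ede_neq //= big_set1.
  have inE1 w v' : w \in BS v' -> (w \in BS u) = (v' == u).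
    by move=> wv; apply/idP/eqP => [/(BS_eq wv)//|<-].
  rewrite (inE1 _ _ a1) (inE1 _ _ a2).
  by case: (F2_cases (v (ede a))) => -> /=; rewrite ?mul0r ?addr0 // mul1r;
    case: (_ == _); case: (_ == _).
Qed.

(* Deleting the edges of the complex that are not in the minor, as in MacLane's
   planarity criterion, turns the triangles into a family ws of cycles of the graph
   that covers each edge at most twice; so 5 |ws| <= 2 |D| by the girth.  The functions
   on D orthogonal to ws (the set Q) extend to closed cochains, and those whose
   extension is exact are coboundaries of the graph. *)
Lemma minor_card_le r :
  (#|coboundary_on D @: [set: {ffun V -> 'F_2}]%SET| <= 2 ^ r)%N ->
  (3 * #|D| <= 5 * (r + g))%N.
Proof.
move=> card_cob.
pose vs0 := [seq boundary s | s <- enum tris].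
have vs0_2 : covers_twice vs0.
  move=> x; rewrite /vs0 count_map.
  have [x2|x2] := eqVneq #|x| 2; last first.
    rewrite (eq_count (a2 := pred0)) ?count_pred0 // => s /=.
    by rewrite ffunE (negbTE x2) andbF eqxx.
  apply: leq_trans (tris2 x2); rewrite -size_filter cardE.
  apply: uniq_leq_size; first by rewrite filter_uniq ?enum_uniq.
  move=> s; rewrite mem_filter => /andP[bs]; rewrite mem_enum => sT.
  rewrite mem_enum inE sT /=; move: bs; rewrite /= ffunE.
  by case: (x \subset s).
have [vs [vs_2 vsP vs_del vs_ext]] := covers_twice_delete deleted vs0_2.
have vs_even : {in vs, forall v, even_vec v}.
  apply: vsP; first exact: even_vecD.
  by move=> v /mapP[s]; rewrite mem_enum => sT ->; apply: even_boundary; apply: tris3.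
pose ws := [seq restr v | v <- vs & restr v != 0].
have ws_card : (5 * size ws <= 2 * #|D|)%N.
  rewrite size_map.
  have : (\sum_(v <- [seq v <- vs | restr v != 0%R]) 5 <=
      \sum_(v <- vs) \sum_(a in D) (v (ede a) != 0%R))%N.
    rewrite big_filter big_mkcond /=; rewrite !big_seq; apply: leq_sum => v vvs.
    case: ifP => // rv; apply: leq_trans (bs_even (vs_even v vvs) (fun x xd => vs_del v x vvs xd) rv) _.
    rewrite -sum1_card big_mkcond [leqRHS]big_mkcond; apply: leq_sum => a _.
    by rewrite inE; case: (a \in D) => //=; case: (_ != _).
  rewrite big_const_seq count_predT iter_addn addn0 => h; apply: leq_trans h _.
  rewrite exchange_big /= mulnC -sum_nat_const; apply: leq_sum => a _.
  apply: leq_trans (vs_2 (ede a)); rewrite -sum1_count [leqRHS]big_mkcond /=.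
  by apply: leq_sum => v _; case: (_ != _).
pose Q := [set phi : {ffun E -> 'F_2} | [forall i : 'I_(size ws), (\sum_j ws`_i j * phi j == 0)%R]].
have Q_card : (2 ^ #|D| <= #|Q| * 2 ^ size ws)%N.
  have := card_kernel_duality (fun i : 'I_(size ws) => fun j : E => ws`_i j).
  rewrite card_ord card_sig -/Q => ->.
  rewrite [#|[pred _ | _]|](@eq_card _ _ (mem D)) // leq_pmull //.
  apply/card_gt0P; exists 0; rewrite inE; apply/forallP => j.
  by rewrite big1 // => i _; rewrite ffunE mul0r.
have QP phi : phi \in Q -> {in vs, forall v, dot v (extend phi) = 0}.
  rewrite inE => /forallP Qphi v vvs; rewrite dot_extend.
  have [->|rv] := eqVneq (restr v) 0.
    by rewrite /dot big1 // => i _; rewrite ffunE mul0r.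
  have wv : restr v \in ws by apply: map_f; rewrite mem_filter rv.
  have := wv; rewrite -index_mem => iv; have := Qphi (Ordinal iv) => /eqP <-.
  by apply: eq_bigr => j _; rewrite /= nth_index.
have ext phi : {f | phi \in Q -> [/\ closed_cochain tris f,
    forall a : E, f (ede (val a)) = phi a & forall x, inside x -> f x = 0]}.
  apply: cid; have [pQ|pQ] := boolP (phi \in Q); last by exists 0.
  have [f fE fvs] := vs_ext _ (QP _ pQ).
  exists f => _; split.
  - by move=> s sT; apply: fvs; apply: map_f; rewrite mem_enum.
  - move=> a; rewrite fE ?extend_ede // mem_filter (imset_f ede (valP a)) andbF //.
  - by move=> x xi; rewrite fE ?extend_inside // mem_filter xi.
pose F phi := sval (ext phi).
have FP phi : phi \in Q -> [/\ closed_cochain tris (F phi),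
    forall a : E, F phi (ede (val a)) = phi a & forall x, inside x -> F phi x = 0].
  exact: (svalP (ext phi)).
set cob := (coboundary_on D @: _)%SET in card_cob.
(* The difference of the two extensions has a potential. It is constant on each branch set, since
   the extensions vanish on inside edges, and thus descends to [V]. *)
have same phi1 phi2 : phi1 \in Q -> phi2 \in Q -> bar (F phi1) - bar (F phi2) \in Bs ->
    phi1 - phi2 \in cob.
  move=> /FP[c1 e1 i1] /FP[c2 e2 i2]; rewrite -barB.
  case/(exact_bar (closed_cochainB c1 c2)) => eta etaE.
  have eta_const v : {in BS v &, forall a b, eta a = eta b}.
    apply: BS_conn => a b av bv ab; apply: addF2_eq0; rewrite -etaE //.
    have ins : inside [set a; b]%SET.
      apply/existsP; exists v; apply/exists_inP; exists a => //.
      by apply/exists_inP; exists b; rewrite // ab eqxx.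
    by rewrite !ffunE i1 // i2 // subrr.
  apply/imsetP; exists [ffun v => if [pick w in BS v] is Some w then eta w else 0] => //.
  have pickE w v : w \in BS v -> (if [pick w in BS v] is Some w then eta w else 0) = eta w.
    by move=> wv; case: pickP => [w' wv'|/(_ w)]; [exact: eta_const wv' wv|rewrite wv].
  apply/ffunP => a; rewrite !ffunE; have [a1 a2] := ed_in (valP a).
  rewrite (pickE _ _ a1) (pickE _ _ a2) -etaE ?ed_adj ?(valP a) //.
  by rewrite !ffunE -[[set _; _]%SET]/(ede (val a)) e1 e2.
(* The extension [F] is a choice and need not be linear, so quotients are avoided: [rep] selects one
   member of [Q] in the class of [z], and [Phi] records a pair by its class data and its difference
   from [rep]. *)
pose rep z : {ffun E -> 'F_2} := if [pick p : {ffun E -> 'F_2} * {ffun Y -> 'F_2} |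
   [&& p.1 \in Q, p.2 \in Bs & bar (F p.1) + p.2 == z]] is Some p then p.1 else 0.
pose Phi (p : {ffun E -> 'F_2} * {ffun Y -> 'F_2}) := (bar (F p.1) + p.2,
   p.1 - rep (bar (F p.1) + p.2)).
have card_QB : (#|Q| * #|Bs| <= #|Zs| * #|cob|)%N.
  rewrite -!cardsX -(card_in_imset (f := Phi) (D := finset.setX Q Bs)); last first.
    move=> [p1 b1] [p2 b2] _ _ [e1]; rewrite e1 => /addIr e2.
    by move: e1; rewrite e2 => /addrI ->.
  apply/subset_leq_card/fintype.subsetP => _ /imsetP[[phi b] + ->].
  rewrite !finset.in_setX /= => /andP[pQ bB]; apply/andP; split.
    by have [c _ _] := FP _ pQ; apply: ZsB => //; apply: barZ.
  rewrite /rep; case: pickP => [[phi' b'] /= /and3P[pQ' bB' /eqP e']|/(_ (phi, b))]; last first.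
    by rewrite /= pQ bB eqxx.
  apply: same => //.
  have -> : bar (F phi) - bar (F phi') = b' - b.
    have -> : bar (F phi) = bar (F phi') + b' - b by rewrite e' addrK.
    by rewrite addrAC [_ + b' - _]addrAC subrr add0r.
  exact: BsB.
have Bs_gt0 : (0 < #|Bs|)%N by apply/card_gt0P; exists 0.
have Q_le : (#|Q| <= 2 ^ (g + r))%N.
  rewrite -(leq_pmul2r Bs_gt0); apply: leq_trans card_QB _.
  rewrite expnD mulnAC; exact: leq_mul.
have : (2 ^ #|D| <= 2 ^ (g + r + size ws))%N.
  by apply: leq_trans Q_card _; rewrite [in leqRHS]expnD leq_mul2r Q_le orbT.
rewrite leq_exp2l //; lia.
Qed.

End Minor.

(** * Grids on a triangulation *)

(** A Poincare lemma: [H], [U], [G] are the values on horizontal, vertical and diagonal edges,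
    closed on both kinds of small triangles. The potential is the integral along the bottom row and
    then upwards. *)
Lemma grid_potential (N : nat) (H U G : nat -> nat -> 'F_2) :
  (forall q r, (q + r < N)%N -> H q r + U q r + G q r = 0) ->
  (forall q r, (q + r + 1 < N)%N -> G q r + H q r.+1 + U q.+1 r = 0) ->
  exists h : nat -> nat -> 'F_2, forall q r, (q + r < N)%N ->
    [/\ H q r = h q r + h q.+1 r, U q r = h q r + h q r.+1 &
        G q r = h q.+1 r + h q r.+1].
Proof.
move=> low up.
pose h q r := \sum_(x < q) H x 0%N + \sum_(y < r) U q y.
have hU q r : U q r = h q r + h q r.+1.
  rewrite /h big_ord_recr /= !addrA -[_ + U q r]addrA.
  set a := \sum_(x < q) _; set b := \sum_(y < r) _; set c := U q r.
  by case: (F2_cases a) => ->; case: (F2_cases b) => ->; case: (F2_cases c) => ->; apply: val_inj.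
have hH q r : (q + r < N)%N -> H q r = h q r + h q.+1 r.
  elim: r => [|r IH] qr.
    rewrite /h !big_ord0 !addr0 big_ord_recr /=.
    set a := \sum_(x < q) _; set c := H q 0%N.
    by case: (F2_cases a) => ->; case: (F2_cases c) => ->; apply: val_inj.
  have e1 := low q r ltac:(lia); have e2 := up q r ltac:(lia).
  have e3 := IH ltac:(lia); have e4 := hU q r; have e5 := hU q.+1 r.
  have e6 : H q r.+1 = H q r + U q r + U q.+1 r.
    apply: addF2_eq0.
    have -> : H q r.+1 + (H q r + U q r + U q.+1 r) =
      (H q r + U q r + G q r) + (G q r + H q r.+1 + U q.+1 r) - (G q r + G q r) by ring.
    by rewrite e1 e2 add0r addF2 subr0.
  rewrite e6 e3 e4 e5.
  set a := h q r; set b := h q.+1 r; set c := h q r.+1; set d := h q.+1 r.+1.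
  by case: (F2_cases a) => ->; case: (F2_cases b) => ->; case: (F2_cases c) => ->;
      case: (F2_cases d) => ->; apply: val_inj.
exists h => q r qr; split => //; first exact: hH.
have := low q r qr; rewrite (hH _ _ qr) hU.
move=> e1; apply: addF2_eq0.
have -> : G q r + (h q.+1 r + h q r.+1) =
  h q r + h q.+1 r + (h q r + h q r.+1) + G q r - (h q r + h q r) by ring.
by rewrite e1 addF2 subrr.
Qed.

Section Grid.
Variables (m N : nat).
Notation W := {ffun 'I_m -> 'I_N.+1}.
Implicit Types (t d : {set 'I_m}) (a b c : W) (i j l : 'I_m).

(* The points a / N subdivide the triangle t into N ^ 2 small triangles. *)
Definition lat t a : bool :=
  (\sum_i a i == N)%N && [forall i, (a i != 0 :> nat)%N ==> (i \in t)].

(** For points of one triangle the coordinate sums agree, so this is equality or adjacency in the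
    triangular lattice. *)
Definition nearby a b : bool := [forall i, (a i <= (b i).+1)%N && (b i <= (a i).+1)%N].

Lemma near_sym a b : nearby a b = nearby b a.
Proof. by apply: eq_forallb => i; rewrite andbC. Qed.

Lemma nearP a b : nearby a b -> forall i, (a i <= (b i).+1)%N /\ (b i <= (a i).+1)%N.
Proof. by move=> /forallP H i; apply/andP. Qed.

Lemma latP i j l a : i != j -> i != l -> j != l ->
  reflect ((a i + a j + a l = N)%N /\ forall x, x != i -> x != j -> x != l -> a x = 0%N :> nat)
    (lat [set i; j; l]%SET a).
Proof.
move=> ij il jl; have supp : [forall x, (a x != 0 :> nat)%N ==> (x \in [set i; j; l]%SET)] =
    [forall x, (x != i) && (x != j) && (x != l) ==> (a x == 0 :> nat)%N].
  apply: eq_forallb => x; rewrite !inE; case: (x == i); case: (x == j); case: (x == l);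
    by rewrite /= ?implybT ?implybF ?negbK.
have sumE : (forall x, x != i -> x != j -> x != l -> a x = 0%N :> nat) ->
    (\sum_x a x = a i + a j + a l)%N.
  move=> a0; rewrite (bigD1 i) //= (bigD1 j) 1?eq_sym //= (bigD1 l) /=; last first.
    by rewrite ![l == _]eq_sym il jl.
  by rewrite big1 ?addn0 ?addnA // => x /andP[/andP[xi xj] xl]; apply: a0.
rewrite /lat supp; apply: (iffP andP) => [[/eqP sa /forallP a0]|[sa a0]].
  have {}a0 x : x != i -> x != j -> x != l -> a x = 0%N :> nat.
    by move=> xi xj xl; have := a0 x; rewrite xi xj xl => /eqP.
  by rewrite -sumE.
rewrite sumE // sa; split => //; apply/forallP => x; apply/implyP => /andP[/andP[xi xj] xl].
by rewrite a0.
Qed.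

Lemma ffun_ord_eq i j l a b :
  (forall x, x != i -> x != j -> x != l -> a x = b x :> nat) ->
  a i = b i :> nat -> a j = b j :> nat -> a l = b l :> nat -> a = b.
Proof.
move=> ab ai aj al; apply/ffunP => x; apply: val_inj => /=.
have [->//|xi] := eqVneq x i; have [->//|xj] := eqVneq x j.
by have [->//|xl] := eqVneq x l; apply: ab.
Qed.

(** It tells the two sides of an edge apart: a third vertex exceeds both ends in the coordinate
    where they agree, or in none. *)
Definition above a b c := [exists x, (a x < c x)%N && (b x < c x)%N].

(* In the triangular lattice an edge ab lies in two triangles, whose third vertices
   come from min(a, b) and max(a, b) by changing the coordinate where a and b agree. *)
Lemma third_nat (ai aj al bi bj bl ci cj cl : nat) :
  (ai + aj + al = N)%N -> (bi + bj + bl = N)%N -> (ci + cj + cl = N)%N ->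
  (ai <= bi.+1)%N /\ (bi <= ai.+1)%N -> (aj <= bj.+1)%N /\ (bj <= aj.+1)%N ->
  (al <= bl.+1)%N /\ (bl <= al.+1)%N ->
  (ai <= ci.+1)%N /\ (ci <= ai.+1)%N -> (aj <= cj.+1)%N /\ (cj <= aj.+1)%N ->
  (al <= cl.+1)%N /\ (cl <= al.+1)%N ->
  (bi <= ci.+1)%N /\ (ci <= bi.+1)%N -> (bj <= cj.+1)%N /\ (cj <= bj.+1)%N ->
  (bl <= cl.+1)%N /\ (cl <= bl.+1)%N ->
  ~ (ai = bi /\ aj = bj /\ al = bl) -> ~ (ai = ci /\ aj = cj /\ al = cl) ->
  ~ (bi = ci /\ bj = cj /\ bl = cl) ->
  let ab := ((ai < ci) && (bi < ci) || (aj < cj) && (bj < cj) || (al < cl) && (bl < cl))%N in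
  let F := fun x y : nat => (if ab then minn x y + (x == y) else maxn x y - (x == y))%N in
  [/\ ci = F ai bi, cj = F aj bj & cl = F al bl].
Proof.
move=> sa sb sc [h1 h2] [h3 h4] [h5 h6] [k1 k2] [k3 k4] [k5 k6] [g1 g2] [g3 g4] [g5 g6].
have [Ei|[Ei|Ei]] : ai = bi \/ ai = bi.+1 \/ bi = ai.+1 by lia.
all: have [Ej|[Ej|Ej]] : aj = bj \/ aj = bj.+1 \/ bj = aj.+1 by lia.
all: have [El|[El|El]] : al = bl \/ al = bl.+1 \/ bl = al.+1 by lia.
all: subst; try (exfalso; lia).
all: move=> n1 n2 n3 /=.
all: rewrite ?eqxx.
all: rewrite ?(ltn_eqF (ltnSn _)) ?(gtn_eqF (ltnSn _)).
all: rewrite ?minnn ?maxnn ?(minn_idPl (leqnSn _)) ?(minn_idPr (leqnSn _))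
  ?(maxn_idPl (leqnSn _)) ?(maxn_idPr (leqnSn _)).
all: case: ifP => ab; split; lia.
Qed.

Lemma third_vertex t a b c c' : #|t| = 3 -> lat t a -> lat t b -> lat t c -> lat t c' ->
  nearby a b -> nearby a c -> nearby b c -> nearby a c' -> nearby b c' ->
  a != b -> a != c -> b != c -> a != c' -> b != c' ->
  above a b c = above a b c' -> c = c'.
Proof.
move=> /cards3E[i [j [l [ij il jl ->]]]].
move=> /(latP _ ij il jl)[sa za] /(latP _ ij il jl)[sb zb] /(latP _ ij il jl)[sc zc]
  /(latP _ ij il jl)[sc' zc'].
move=> /nearP nab /nearP nac /nearP nbc /nearP nac' /nearP nbc'.
have neq (u v : W) : (forall x, x != i -> x != j -> x != l -> u x = 0%N :> nat) ->
    (forall x, x != i -> x != j -> x != l -> v x = 0%N :> nat) -> u != v ->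
    ~ (u i = v i :> nat /\ u j = v j :> nat /\ u l = v l :> nat).
  move=> zu zv /eqP uv [e1 [e2 e3]]; apply: uv; apply: (ffun_ord_eq _ e1 e2 e3) => x xi xj xl.
  by rewrite zu // zv.
move=> /(neq _ _ za zb) ab /(neq _ _ za zc) ac /(neq _ _ zb zc) bc
  /(neq _ _ za zc') ac' /(neq _ _ zb zc') bc'.
have aboveE (u : W) : (forall x, x != i -> x != j -> x != l -> u x = 0%N :> nat) ->
    above a b u = ((a i < u i) && (b i < u i) || (a j < u j) && (b j < u j) ||
       (a l < u l) && (b l < u l))%N.
  move=> zu; apply/existsP/idP => [[x]|].
    have [->->//|xi] := eqVneq x i; have [->->|xj] := eqVneq x j; first by rewrite orbT.
    have [->->|xl] := eqVneq x l; first by rewrite orbT.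
    by rewrite (zu x).
  by case/orP => [/orP[]|] h; [exists i|exists j|exists l].
rewrite !aboveE // => abE.
have [ci cj cl] := third_nat sa sb sc (nab i) (nab j) (nab l) (nac i) (nac j) (nac l)
  (nbc i) (nbc j) (nbc l) ab ac bc.
have [ci' cj' cl'] := third_nat sa sb sc' (nab i) (nab j) (nab l) (nac' i) (nac' j) (nac' l)
  (nbc' i) (nbc' j) (nbc' l) ab ac' bc'.
have e1 : c i = c' i :> nat by rewrite ci ci' abE.
have e2 : c j = c' j :> nat by rewrite cj cj' abE.
have e3 : c l = c' l :> nat by rewrite cl cl' abE.
by apply: (ffun_ord_eq _ e1 e2 e3) => x xi xj xl; rewrite zc // zc'.
Qed.
End Grid.

Lemma near3_nat (u v w : nat) : (u <= v.+1)%N -> (v <= u.+1)%N -> (u <= w.+1)%N ->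
  (w <= u.+1)%N -> (v <= w.+1)%N -> (w <= v.+1)%N -> u <> v -> u <> w -> v <> w -> False.
Proof. lia. Qed.

Section GridComplex.
Variables (m N : nat) (F : {set {set 'I_m}}).
Notation W := {ffun 'I_m -> 'I_N.+1}.
Hypothesis F3 : {in F, forall t : {set 'I_m}, #|t| = 3}.
Hypothesis Fedge : forall d : {set 'I_m}, d \in triangulation_edges F ->
  #|[set t in F | d \subset t]| = 2.

Definition gadj : rel W := fun a b =>
  [&& a != b, nearby a b & [exists t in F, lat t a && lat t b]].

Definition gtris : {set {set W}} := [set s : {set W} | [&& #|s| == 3,
  [exists t in F, [forall a in s, lat t a]] & [forall a in s, forall b in s, nearby a b]]].

Lemma gadj_irr : irreflexive gadj.
Proof. by move=> a; rewrite /gadj eqxx. Qed.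

Lemma gtris3 : {in gtris, forall s : {set W}, #|s| = 3}.
Proof. by move=> s; rewrite inE => /and3P[/eqP]. Qed.

Lemma gtrisI (t : {set 'I_m}) (a b c : W) : t \in F -> lat t a -> lat t b -> lat t c ->
  nearby a b -> nearby a c -> nearby b c -> a != b -> a != c -> b != c ->
  [set a; b; c]%SET \in gtris.
Proof.
move=> tF la lb lc ab ac bc nab nac nbc; rewrite inE cards3 //=; apply/andP; split.
  apply/exists_inP; exists t => //; apply/forall_inP => x.
  by rewrite !inE => /orP[/orP[]|] /eqP ->.
have nn (x : W) : nearby x x by apply/forallP => i; rewrite leqnSn.
apply/forall_inP => x + ; rewrite !inE => xs; apply/forall_inP => y; rewrite !inE => ys.
by case/orP: xs => [/orP[]|] /eqP ->; case/orP: ys => [/orP[]|] /eqP -> //; rewrite near_sym.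
Qed.

Definition supp (a : W) : {set 'I_m} := [set i | (a i != 0 :> nat)%N].

Lemma lat_supp t (a : W) : lat t a -> supp a \subset t.
Proof.
by rewrite /lat => /andP[_ /forallP at_]; apply/fintype.subsetP => i; rewrite inE; apply/implyP.
Qed.

Lemma lat_sum t (a : W) : lat t a -> (\sum_i a i)%N = N.
Proof. by rewrite /lat => /andP[/eqP]. Qed.

(** Equal coordinate sums force one coordinate where [a] is larger and another where [b] is
    larger. *)
Lemma supp2 t (a b : W) : lat t a -> lat t b -> a != b -> (1 < #|supp a :|: supp b|)%N.
Proof.
move=> la lb ab.
have lt_ex (u v : W) x : lat t u -> lat t v -> (u x < v x)%N -> exists y, (v y < u y)%N.
  move=> /lat_sum su /lat_sum sv uv; apply/existsP; apply: contraT; rewrite negb_exists => /forallP H.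
  have : (\sum_i u i < \sum_i v i)%N.
    rewrite (bigD1 x) //= [ltnRHS](bigD1 x) //= -addSn leq_add //.
    by apply: leq_sum => y _; have := H y; rewrite -leqNgt.
  by rewrite su sv ltnn.
have [x abx] : exists x, (a x != b x :> nat)%N.
  apply/existsP; apply: contraT; rewrite negb_exists => /forallP H.
  have e : a = b by apply/ffunP => x; apply: val_inj; apply/eqP/negPn/H.
  by rewrite e eqxx in ab.
have [y [z [yz ys zs]]] : exists y z, [/\ y != z, y \in supp a :|: supp b & z \in supp a :|: supp b].
  case: (ltngtP (a x) (b x)) abx => // [lt|lt] _; [have [y lt'] := lt_ex _ _ _ la lb lt|
      have [y lt'] := lt_ex _ _ _ lb la lt]; exists x, y; split; rewrite ?inE;
    try (by apply/eqP => xy; move: lt lt'; rewrite xy; lia); apply/orP; rewrite -!lt0n.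
  - by right; lia.
  - by left; lia.
  - by left; lia.
  - by right; lia.
rewrite (cardsD1 y) ys add1n ltnS; apply/card_gt0P; exists z.
by rewrite in_setD1 eq_sym yz.
Qed.

(** If the edge lies on an edge of [F], two triangles of [F] contain it, and each offers only one
    side. Otherwise the joint support of its ends is a single triangle of [F], which offers both
    sides. *)
Lemma gtris2 (x : {set W}) : #|x| = 2 -> (#|[set s in gtris | x \subset s]| <= 2)%N.
Proof.
move=> /eqP/cards2P[a [b [ab xE]]]; set S := [set s in _ | _].
pose Q s (p : {set 'I_m} * W) := [/\ p.1 \in F, s = [set a; b; p.2]%SET,
   [/\ lat p.1 a, lat p.1 b & lat p.1 p.2], [/\ nearby a b, nearby a p.2 & nearby b p.2] &
   a != p.2 /\ b != p.2].
have exQ s : exists p, s \in S -> Q s p.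
  case: (boolP (s \in S)) => [|sNS]; last by exists (finset.set0, a).
  rewrite !inE xE => /andP[/and3P[/eqP s3 /exists_inP[t tF /forall_inP ts] /forall_inP ns] xs].
  have as_ : a \in s by apply: (fintype.subsetP xs); rewrite !inE eqxx.
  have bs : b \in s by apply: (fintype.subsetP xs); rewrite !inE eqxx orbT.
  have : (0 < #|s :\: [set a; b]%SET|)%N.
    have := cardsID [set a; b]%SET s; rewrite s3 (finset.setIidPr xs) cards2 ab; lia.
  case/card_gt0P => c; rewrite !inE negb_or => /andP[/andP[ca cb] cs].
  exists (t, c) => _; split => //=.
  - apply/esym/eqP; rewrite eqEcard s3 cards3 // 1?eq_sym // leqnn andbT.
    by apply/fintype.subsetP => z; rewrite !inE => /orP[/orP[]|] /eqP ->.
  - by split; apply: ts.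
  - by split; apply: (forall_inP (ns _ _)).
  - by rewrite ![_ == c]eq_sym.
have [tc tcP] := boolp.choice exQ.
have inj_tc s s' : s \in S -> s' \in S -> (tc s).1 = (tc s').1 ->
    above a b (tc s).2 = above a b (tc s').2 -> s = s'.
  move=> /tcP[tF sE [la lb lc] [nab nac nbc] [ac bc]].
  move=> /tcP[_ s'E [_ _ lc'] [_ nac' nbc'] [ac' bc']] et eab; rewrite -et in lc'.
  have e := third_vertex (F3 tF) la lb lc lc' nab nac nbc nac' nbc' ab ac bc ac' bc' eab.
  by rewrite sE s'E e.
pose sg := supp a :|: supp b.
have sg_sub s : s \in S -> sg \subset (tc s).1.
  by move=> /tcP[_ _ [la lb _] _ _]; rewrite finset.subUset !lat_supp.
case: (set_0Vmem S) => [->|[s0 s0S]]; first by rewrite cards0.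
have sg2 : (1 < #|sg|)%N by have [_ _ [la lb _] _ _] := tcP _ s0S; apply: supp2 la lb ab.
have [sgE|sg3] := eqVneq #|sg| 2.
  have sgF : sg \in triangulation_edges F.
    rewrite inE sgE eqxx; apply/exists_inP; exists (tc s0).1; last exact: sg_sub.
    by have [] := tcP _ s0S.
  (* The coordinate [l] opposite to the edge is 0 at [a] and [b]. If it were 0 at the third vertex
     too, three distinct points of a segment would be pairwise near. *)
  have abv s : s \in S -> above a b (tc s).2.
    move=> sS; have [tF _ [la lb lc] [nab nac nbc] [ac bc]] := tcP _ sS.
    move/eqP/cards2P: (sgE) => [i [j [ij sij]]].
    have := cardsID sg (tc s).1; rewrite (finset.setIidPr (sg_sub _ sS)) sgE (F3 tF) => /eqP.
    rewrite -[3]/(2 + 1)%N eqn_add2l => /cards1P[l lE].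
    have : l \in (tc s).1 :\: sg by rewrite lE inE.
    rewrite finset.in_setD sij !inE negb_or => /andP[/andP[li lj] lt].
    have tE : (tc s).1 = [set i; j; l]%SET.
      by rewrite -(finset.setID (tc s).1 sg) (finset.setIidPr (sg_sub _ sS)) lE sij.
    have il : i != l by rewrite eq_sym.
    have jl : j != l by rewrite eq_sym.
    rewrite tE in la lb lc.
    have nl (u : W) : (forall x, x \in supp u -> x \in sg) -> u l = 0%N :> nat.
      move=> us; apply/eqP/negPn/negP => ul; have := us l; rewrite sij !inE ul => /(_ isT).
      by rewrite (negbTE li) (negbTE lj).
    have al : a l = 0%N :> nat by apply: nl => y ys; rewrite inE ys.
    have bl : b l = 0%N :> nat by apply: nl => y ys; rewrite inE ys orbT.
    apply/existsP; exists l; rewrite al bl andbb lt0n; apply/eqP => cl.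
    move: (latP _ ij il jl la) (latP _ ij il jl lb) (latP _ ij il jl lc) => [sa za] [sb zb] [sc zc].
    have [h1 h2] := nearP nab i; have [h3 h4] := nearP nac i; have [h5 h6] := nearP nbc i.
    have neq (u v : W) : (forall x, x != i -> x != j -> x != l -> u x = 0%N :> nat) ->
        (forall x, x != i -> x != j -> x != l -> v x = 0%N :> nat) -> u l = v l :> nat ->
        (u i + u j + u l = v i + v j + v l)%N -> u != v -> u i <> v i :> nat.
      move=> zu zv ul suv /eqP uv ui; apply: uv.
      have uj : u j = v j :> nat by move: ul suv ui; clear; lia.
      by apply: (ffun_ord_eq _ ui uj ul) => y yi yj yl; rewrite zu // zv.
    have n1 : a i <> b i :> nat by exact: neq _ _ za zb (etrans al (esym bl)) (etrans sa (esym sb)) ab.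
    have n2 : a i <> (tc s).2 i :> nat by exact: neq _ _ za zc (etrans al (esym cl)) (etrans sa (esym sc)) ac.
    have n3 : b i <> (tc s).2 i :> nat by exact: neq _ _ zb zc (etrans bl (esym cl)) (etrans sb (esym sc)) bc.
    exact: near3_nat h1 h2 h3 h4 h5 h6 n1 n2 n3.
  apply: (@leq_trans #|[set t in F | sg \subset t]|); last by rewrite Fedge.
  rewrite -(card_in_imset (f := fun s => (tc s).1) (D := S)); last first.
    by move=> s s' sS s'S e; apply: inj_tc => //; rewrite !abv.
  apply/subset_leq_card/fintype.subsetP => _ /imsetP[s sS ->].
  by rewrite inE sg_sub //; have [-> _ _ _ _] := tcP _ sS.
have tE s : s \in S -> (tc s).1 = sg.
  move=> sS; apply/esym/eqP; rewrite eqEcard sg_sub // F3; last by have [] := tcP _ sS.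
  by move: sg2 sg3; case: #|sg| => [|[|[|]]].
rewrite -(card_in_imset (f := fun s => above a b (tc s).2) (D := S)); last first.
  by move=> s s' sS s'S e; apply: inj_tc => //; rewrite !tE.
by rewrite -card_bool max_card.
Qed.

End GridComplex.

(** * Cohomology of the grid and of the triangulation *)

Section GridCohomology.
Variables (m N : nat) (F : {set {set 'I_m}}).
Notation W := {ffun 'I_m -> 'I_N.+1}.
Hypothesis F3 : {in F, forall t : {set 'I_m}, #|t| = 3}.
Implicit Types (f : {ffun {set W} -> 'F_2}) (t : {set 'I_m}).

Definition potential t f (h : W -> 'F_2) : Prop := forall a b,
  lat t a -> lat t b -> nearby a b -> a != b -> f [set a; b]%SET = h a + h b.

Lemma closed_tri f t (a b c : W) : closed_cochain (@gtris m N F) f -> t \in F ->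
  lat t a -> lat t b -> lat t c ->
  nearby a b -> nearby a c -> nearby b c -> a != b -> a != c -> b != c ->
  f [set b; c]%SET + f [set a; c]%SET + f [set a; b]%SET = 0.
Proof.
move=> cf tF la lb lc nab nac nbc ab ac bc.
by have := cf _ (gtrisI tF la lb lc nab nac nbc ab ac bc); rewrite dot_boundary sum_subsets2.
Qed.

Lemma tri_potential f t : closed_cochain (@gtris m N F) f -> t \in F ->
  exists h, potential t f h.
Proof.
move=> cf tF; have [i [j [l [ij il jl tE]]]] := cards3E (F3 tF).
pose pt q r : W := [ffun x => inord (if x == i then N - q - r else
  if x == j then q else if x == l then r else 0)%N].
have ptv q r x : (q + r <= N)%N ->
    pt q r x = (if x == i then N - q - r else if x == j then q else if x == l then r else 0)%N :> nat.
  move=> qr; rewrite ffunE inordK //.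
  by case: ifP => _; [lia|case: ifP => _; [lia|case: ifP => _; lia]].
have pti q r : (q + r <= N)%N -> pt q r i = (N - q - r)%N :> nat by move=> qr; rewrite ptv // eqxx.
have ptj q r : (q + r <= N)%N -> pt q r j = q :> nat.
  by move=> qr; rewrite ptv // [j == i]eq_sym (negbTE ij) eqxx.
have ptl q r : (q + r <= N)%N -> pt q r l = r :> nat.
  by move=> qr; rewrite ptv // ![l == _]eq_sym (negbTE il) (negbTE jl) eqxx.
have pt0 q r x : (q + r <= N)%N -> x != i -> x != j -> x != l -> pt q r x = 0%N :> nat.
  by move=> qr xi xj xl; rewrite ptv // (negbTE xi) (negbTE xj) (negbTE xl).
have lpt q r : (q + r <= N)%N -> lat t (pt q r).
  move=> qr; rewrite tE; apply/(latP _ ij il jl); split; last by move=> x; apply: pt0.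
  by rewrite pti // ptj // ptl //; lia.
have ptE a : lat t a -> (a j + a l <= N)%N /\ pt (a j) (a l) = a.
  rewrite tE => /(latP _ ij il jl)[sa za]; have s : (a j + a l <= N)%N by lia.
  split => //; apply: (@ffun_ord_eq _ _ i j l); rewrite ?pti ?ptj ?ptl //; last by lia.
  by move=> x xi xj xl; rewrite pt0 // za.
have npt q r q' r' : (q + r <= N)%N -> (q' + r' <= N)%N -> (q <= q'.+1)%N -> (q' <= q.+1)%N ->
   (r <= r'.+1)%N -> (r' <= r.+1)%N -> (q + r <= (q' + r').+1)%N -> (q' + r' <= (q + r).+1)%N ->
   nearby (pt q r) (pt q' r').
  move=> *; apply/forallP => x; rewrite !ptv //.
  by case: ifP => _; [lia|case: ifP => _; [lia|case: ifP => _; lia]].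
have ptN q r q' r' : (q + r <= N)%N -> (q' + r' <= N)%N -> (q != q') || (r != r') ->
    pt q r != pt q' r'.
  move=> h1 h2 h; apply/eqP => e; move: h.
  have := congr1 (fun u : W => (nat_of_ord (u j), nat_of_ord (u l))) e.
  by rewrite /= !ptj // !ptl // => -[-> ->]; rewrite !eqxx.
have low q r : (q + r < N)%N -> f [set pt q r; pt q.+1 r]%SET +
    f [set pt q r; pt q r.+1]%SET + f [set pt q.+1 r; pt q r.+1]%SET = 0.
  move=> qr; rewrite -(@closed_tri f t (pt q r) (pt q.+1 r) (pt q r.+1) cf tF) ?lpt ?npt ?ptN //;
    try lia; ring.
have up q r : (q + r + 1 < N)%N -> f [set pt q.+1 r; pt q r.+1]%SET +
    f [set pt q r.+1; pt q.+1 r.+1]%SET + f [set pt q.+1 r; pt q.+1 r.+1]%SET = 0.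
  move=> qr.
  rewrite -(@closed_tri f t (pt q.+1 r) (pt q r.+1) (pt q.+1 r.+1) cf tF) ?lpt ?npt ?ptN //;
    try lia; ring.
have [h0 h0P] := grid_potential low up.
pose h (a : W) := h0 (a j) (a l).
have step (a b : W) : lat t a -> lat t b -> [\/ b j = (a j).+1 :> nat /\ b l = a l :> nat,
     b j = a j :> nat /\ b l = (a l).+1 :> nat | a j = (b j).+1 :> nat /\ b l = (a l).+1 :> nat] ->
    f [set a; b]%SET = h a + h b.
  move=> /ptE[sa aE] /ptE[sb bE] E; rewrite -{1}aE -{1}bE /h.
  by case: E => -[e1 e2]; rewrite e1 e2; [have [] := h0P (a j) (a l) ltac:(lia)|
    have [] := h0P (a j) (a l) ltac:(lia)|have [] := h0P (b j) (a l) ltac:(lia)].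
exists h => a b la lb nab ab.
have [sa aE] := ptE _ la; have [sb bE] := ptE _ lb.
have neq : ~ (a j = b j :> nat /\ a l = b l :> nat).
  by move=> [e1 e2]; move/eqP: ab; apply; rewrite -aE -bE e1 e2.
have [h1 h2] := nearP nab i; have [h3 h4] := nearP nab j; have [h5 h6] := nearP nab l.
have ai : nat_of_ord (a i) = (N - a j - a l)%N by rewrite -{1}aE pti.
have bi : nat_of_ord (b i) = (N - b j - b l)%N by rewrite -{1}bE pti.
(* There are six lattice directions; [step] treats three of them, and the symmetry of an edge the
   others. *)
have [E|E] : [\/ b j = (a j).+1 :> nat /\ b l = a l :> nat,
     b j = a j :> nat /\ b l = (a l).+1 :> nat | a j = (b j).+1 :> nat /\ b l = (a l).+1 :> nat] \/
   [\/ a j = (b j).+1 :> nat /\ a l = b l :> nat,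
     a j = b j :> nat /\ a l = (b l).+1 :> nat | b j = (a j).+1 :> nat /\ a l = (b l).+1 :> nat].
- have [E1|[E1|E1]] : a j = b j :> nat \/ a j = (b j).+1 :> nat \/ b j = (a j).+1 :> nat by lia.
  + have [E2|E2] : b l = (a l).+1 :> nat \/ a l = (b l).+1 :> nat by lia.
      by left; apply: Or32.
    by right; apply: Or32.
  + have [E2|E2] : a l = b l :> nat \/ b l = (a l).+1 :> nat by lia.
      by right; apply: Or31.
    by left; apply: Or33.
  + have [E2|E2] : a l = b l :> nat \/ a l = (b l).+1 :> nat by lia.
      by left; apply: Or31.
    by right; apply: Or33.
- exact: step.
- by rewrite finset.setUC addrC; apply: step.
Qed.

Definition corner (i : 'I_m) : W := [ffun x => inord (if x == i then N else 0)%N].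

Definition seg (i j : 'I_m) (q : nat) : W :=
  [ffun x => inord (if x == j then q else if x == i then N - q else 0)%N].

Lemma segE i j q x : (q <= N)%N ->
  seg i j q x = (if x == j then q else if x == i then N - q else 0)%N :> nat.
Proof.
by move=> qN; rewrite ffunE inordK //; case: ifP => _; [lia|case: ifP => _; lia].
Qed.

Lemma seg0 i j : i != j -> seg i j 0 = corner i.
Proof.
move=> ij; apply/ffunP => x; apply: val_inj; rewrite /= !ffunE subn0.
by case: (eqVneq x j) => [->|//]; rewrite eq_sym (negbTE ij).
Qed.

Lemma segN i j : i != j -> seg i j N = corner j.
Proof.
move=> ij; apply/ffunP => x; apply: val_inj; rewrite /= !ffunE subnn.
by case: (x == j); case: (x == i).
Qed.

Lemma lat_seg t i j q : i != j -> i \in t -> j \in t -> (q <= N)%N -> lat t (seg i j q).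
Proof.
move=> ij it jt qN; apply/andP; split.
  rewrite (bigD1 i) //= (bigD1 j) 1?eq_sym //= !segE // !eqxx (negbTE ij) big1.
    by apply/eqP; lia.
  by move=> x /andP[xi xj]; rewrite segE // (negbTE xi) (negbTE xj).
apply/forallP => x; apply/implyP; rewrite segE //.
by case: (eqVneq x j) => [->//|_]; case: (eqVneq x i) => [->|].
Qed.

Lemma near_seg i j q : (q < N)%N -> nearby (seg i j q) (seg i j q.+1).
Proof.
move=> qN; apply/forallP => x; rewrite !segE // ?(ltnW qN) //.
by case: ifP => _; [lia|case: ifP => _; lia].
Qed.

Definition cpath f (i j : 'I_m) : 'F_2 := \sum_(q < N) f [set seg i j q; seg i j q.+1]%SET.

Lemma sum_seg f t h i j Q : potential t f h -> i != j -> i \in t -> j \in t -> (Q <= N)%N ->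
  \sum_(q < Q) f [set seg i j q; seg i j q.+1]%SET = h (corner i) + h (seg i j Q).
Proof.
move=> pot ij it jt; elim: Q => [|Q IH] QN.
  by rewrite big_ord0 seg0 // addF2.
rewrite big_ord_recr /= IH 1?ltnW // (pot (seg i j Q)) ?lat_seg ?near_seg // 1?ltnW //.
  rewrite -addrA; congr (_ + _); rewrite addrA addF2 add0r //.
apply/eqP => /ffunP/(_ j)/(congr1 val) /=; rewrite !segE ?(ltnW QN) // eqxx; lia.
Qed.

Lemma cpathE f t h i j : potential t f h -> i != j -> i \in t -> j \in t ->
  cpath f i j = h (corner i) + h (corner j).
Proof. by move=> pot ij it jt; rewrite /cpath (sum_seg pot) // segN. Qed.

Notation Y := {d : {set 'I_m} | d \in triangulation_edges F}.

(* The cochain on F whose value at an edge is the sum of f along that edge. *)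
Definition bar f : {ffun Y -> 'F_2} := [ffun d =>
  if [pick p : 'I_m * 'I_m | (p.1 != p.2) && (val d == [set p.1; p.2]%SET)] is Some p
  then cpath f p.1 p.2 else 0].

Lemma barB f1 f2 : bar (f1 - f2) = bar f1 - bar f2.
Proof.
apply/ffunP => d; rewrite !ffunE; case: pickP => [p _|_]; last by rewrite subr0.
by rewrite /cpath -sumrB; apply: eq_bigr => q _; rewrite !ffunE.
Qed.

(** The value is symmetric in the two ends, so the direction picked in [bar] is immaterial here. *)
Lemma bar_potential f t h (d : Y) : potential t f h -> val d \subset t ->
  bar f d = \sum_(i in val d) h (corner i).
Proof.
move=> pot dt; rewrite ffunE; case: pickP => [[i j] /= /andP[ij /eqP dE]|dN]; last first.
  have := valP d; rewrite inE => /andP[/cards2P[i [j [ij dE]]] _].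
  by have := dN (i, j); rewrite /= ij dE eqxx.
have {}dE : val d = [set i; j]%SET := dE.
have it : i \in t by apply: (fintype.subsetP dt); rewrite dE !inE eqxx.
have jt : j \in t by apply: (fintype.subsetP dt); rewrite dE !inE eqxx orbT.
by rewrite dE big_setU1 ?inE //= big_set1 (cpathE pot).
Qed.

Definition closed_edges : {set {ffun Y -> 'F_2}} := [set z : {ffun Y -> 'F_2} |
  [forall t in F, (\sum_(d : Y | val d \subset t) z d == 0)%R]].

Definition edge_cob (eta : {ffun 'I_m -> 'F_2}) : {ffun Y -> 'F_2} :=
  [ffun d => (fun s : {set 'I_m} => \sum_(i in s) eta i) (val d)].

Definition exact_edges : {set {ffun Y -> 'F_2}} := edge_cob @: [set: {ffun 'I_m -> 'F_2}]%SET.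

Lemma sum_edges_cob t (eta : 'I_m -> 'F_2) : t \in F ->
  \sum_(d : Y | val d \subset t) \sum_(i in val d) eta i = 0.
Proof.
move=> tF.
rewrite -(big_sub_cond (mem (triangulation_edges F)) (fun d => d \subset t)
   (fun d => \sum_(i in d) eta i)) /=.
rewrite (eq_bigl (fun x : {set 'I_m} => (x \subset t) && (#|x| == 2))); last first.
  move=> d; rewrite inE andbC; case: (boolP (d \subset t)) => //= dt.
  by case: (_ == 2) => //=; apply/exists_inP; exists t.
have h := even_boundary (F3 tF) eta.
rewrite -[RHS]h [LHS]big_mkcond; apply: eq_bigr => x _; rewrite ffunE.
by case: ifP => _; rewrite ?mul1r ?mul0r.
Qed.

Lemma bar_closed f : closed_cochain (@gtris m N F) f -> bar f \in closed_edges.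
Proof.
move=> cf; rewrite inE; apply/forall_inP => t tF.
have [h pot] := tri_potential cf tF.
rewrite (eq_bigr (fun d : Y => \sum_(i in val d) h (corner i))) => [|d dt].
  by rewrite sum_edges_cob.
exact: bar_potential pot dt.
Qed.

Lemma edge_cobB eta1 eta2 : edge_cob (eta1 - eta2) = edge_cob eta1 - edge_cob eta2.
Proof.
by apply/ffunP => d; rewrite !ffunE -sumrB; apply: eq_bigr => i _; rewrite !ffunE.
Qed.

Lemma exact_edgesB : {in exact_edges &, forall y z, y - z \in exact_edges}.
Proof.
by move=> _ _ /imsetP[e1 _ ->] /imsetP[e2 _ ->]; apply/imsetP; exists (e1 - e2); rewrite // edge_cobB.
Qed.

Lemma exact_edges0 : 0 \in exact_edges.
Proof.
apply/imsetP; exists 0 => //; apply/ffunP => d; rewrite !ffunE big1 // => i _.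
by rewrite ffunE.
Qed.

Lemma closed_edgesD y z : y \in closed_edges -> z \in exact_edges -> y + z \in closed_edges.
Proof.
rewrite !inE => /forall_inP yc /imsetP[eta _ ->]; apply/forall_inP => t tF.
under eq_bigr do rewrite ffunE.
rewrite big_split /= (eqP (yc t tF)) add0r.
by under eq_bigr do rewrite ffunE; rewrite sum_edges_cob.
Qed.

(** Refinement creates no new classes: potentials on the single triangles, normalized at the corners
    by [eta0], agree where triangles meet and glue. *)
Lemma exact_bar f : (0 < N)%N -> closed_cochain (@gtris m N F) f -> bar f \in exact_edges ->
  exists eta : W -> 'F_2, forall a b, @gadj m N F a b -> f [set a; b]%SET = eta a + eta b.
Proof.
move=> N0 cf /imsetP[eta0 _ barE].
have exh t : exists h : W -> 'F_2, t \in F ->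
    potential t f h /\ {in t, forall i, h (corner i) = eta0 i}.
  case: (boolP (t \in F)) => [tF|_]; last by exists (fun=> 0).
  have [h pot] := tri_potential cf tF.
  have /card_gt0P[i0 i0t] : (0 < #|t|)%N by rewrite F3.
  (* The constant adjusts one corner; the others follow because [bar f] is the coboundary of [eta0]
     on the edges of [t]. *)
  exists (fun a => h a + (h (corner i0) + eta0 i0)) => _; split.
    move=> a b la lb nab ab; rewrite (pot a b) //.
    by rewrite addrACA addF2 addr0.
  move=> i it; have [->|ii0] := eqVneq i i0; first by rewrite addrA addF2 add0r.
  have dY : [set i; i0]%SET \in triangulation_edges F.
    rewrite inE cards2 ii0 /=; apply/exists_inP; exists t => //.
    by apply/fintype.subsetP => x; rewrite !inE => /orP[] /eqP ->.
  pose d0 : Y := exist (fun d => is_true (d \in triangulation_edges F)) _ dY.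
  have dt : val d0 \subset t.
    by apply/fintype.subsetP => x; rewrite !inE => /orP[] /eqP ->.
  have := bar_potential pot dt; rewrite barE ffunE /= !big_setU1 ?inE //= !big_set1.
  move=> e; rewrite addrA -e -addrA addF2 addr0 //.
have [h hP] := boolp.choice exh.
(* A point common to two distinct triangles is a corner or lies on a common edge, along which both
   potentials integrate [f] from the same corner value. Empty support is excluded by 0 < N. *)
have same t t' a : t \in F -> t' \in F -> lat t a -> lat t' a -> h t a = h t' a.
  move=> tF t'F la la'; have [->//|tt'] := eqVneq t t'.
  have [pot hc] := hP _ tF; have [pot' hc'] := hP _ t'F.
  have sub : supp a \subset t :&: t' by rewrite finset.subsetI !lat_supp.
  have sub2 : (#|supp a| <= 2)%N.
    rewrite leqNgt; apply/negP => s3; move/eqP: tt'; apply.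
    have e u : u \in F -> lat u a -> supp a = u.
      move=> uF lu; apply/eqP; rewrite eqEcard lat_supp // F3 //.
    by rewrite -(e _ tF la) -(e _ t'F la').
  have aN := lat_sum la.
  have a0 x : x \notin supp a -> a x = 0%N :> nat by rewrite inE negbK => /eqP.
  have [s1|s1] := eqVneq #|supp a| 1%N.
    move/eqP/cards1P: s1 => [i sE].
    have aE : a = corner i.
      apply/ffunP => x; apply: val_inj; rewrite /= ffunE inordK; last by case: ifP.
      case: (eqVneq x i) => [->|xi]; last by rewrite a0 // sE inE.
      by rewrite -[RHS]aN (bigD1 i) //= big1 ?addn0 // => y yi; rewrite a0 // sE inE.
    have iS : i \in t :&: t' by apply: (fintype.subsetP sub); rewrite sE inE.
    by move: iS; rewrite inE => /andP[it it']; rewrite aE hc // hc'.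
  have s2 : #|supp a| == 2.
    move: sub2 s1; case s0: #|supp a| => [|[|[|]]] // _ _.
    move: N0; rewrite -aN big1 // => x _; apply: a0.
    by rewrite (cards0_eq s0) inE.
  move/cards2P: s2 => [i [j [ij sE]]].
  have aij : (a i + a j = N)%N.
    rewrite -[RHS]aN (bigD1 i) //= (bigD1 j) 1?eq_sym //= big1 ?addn0 // => y /andP[yi yj].
    by rewrite a0 // sE !inE negb_or yi.
  have aE : a = seg i j (a j).
    apply/ffunP => x; apply: val_inj; rewrite /= segE; last by lia.
    have [->//|xj] := eqVneq x j; have [->|xi] := eqVneq x i; first by lia.
    by rewrite a0 // sE !inE negb_or xi.
  have : i \in t :&: t' by apply: (fintype.subsetP sub); rewrite sE !inE eqxx.
  have : j \in t :&: t' by apply: (fintype.subsetP sub); rewrite sE !inE eqxx orbT.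
  rewrite !inE => /andP[jt jt'] /andP[it it'].
  have ajN : (a j <= N)%N by apply: leq_trans (leq_addl (a i) _) _; rewrite aij.
  have := sum_seg pot ij it jt ajN; rewrite (sum_seg pot' ij it' jt' ajN) -aE.
  by rewrite hc // hc' // => /addrI.
exists (fun a => if [pick t in F | lat t a] is Some t then h t a else 0).
move=> a b /and3P[ab nab /exists_inP[t tF /andP[la lb]]].
have pickE c : lat t c -> (if [pick t in F | lat t c] is Some t then h t c else 0) = h t c.
  move=> lc; case: pickP => [t' /andP[t'F lc']|/(_ t)]; first exact: same.
  by rewrite tF lc.
rewrite !pickE //; have [pot _] := hP _ tF; exact: pot.
Qed.

End GridCohomology.

(** * The first cohomology of a closed surface *)

Section SurfaceCohomology.
Variables (m : nat) (F : {set {set 'I_m}}) (g : nat).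
Hypothesis surf : combinatorial_surface F.
Hypothesis conn_vertices : forall eta : 'I_m -> 'F_2,
  {in F, forall t : {set 'I_m}, {in t &, forall i j, eta i = eta j}} -> forall i j, eta i = eta j.

Notation Y := {d : {set 'I_m} | d \in triangulation_edges F}.
Notation X := {t : {set 'I_m} | t \in F}.

(** By connectedness only constants have coboundary 0, so an exact cochain and the value at one
    vertex determine the potential. *)
Lemma card_exact_edges : (2 ^ m <= #|exact_edges F| * 2)%N.
Proof.
have [i0 _|m0] := pickP (@predT 'I_m); last first.
  have m_eq0 : m = 0%N.
    by case: (posnP m) => // m_gt0; have := m0 (Ordinal m_gt0).
  have : (0 < #|exact_edges F|)%N by apply/card_gt0P; exists 0; exact: exact_edges0.
  by move=> ex; apply: (@leq_trans 1); [rewrite m_eq0|case: #|_| ex].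
have -> : (2 ^ m = #|[set: {ffun 'I_m -> 'F_2}]|)%N by rewrite cardsT card_ffun !card_ord.
apply: (@leq_trans (#|exact_edges F| * #|[set: 'F_2]|)%N); last by rewrite cardsT card_ord.
rewrite -cardsX -(card_in_imset (f := fun eta => (edge_cob F eta, eta i0)) (D := finset.setT)).
  apply/subset_leq_card/fintype.subsetP => _ /imsetP[eta _ ->].
  by rewrite !inE /= andbT; apply: imset_f.
move=> e1 e2 _ _ [ee e0]; apply/ffunP => i.
suff : (e1 - e2) i = (e1 - e2) i0.
  by rewrite !ffunE e0 subrr => /eqP; rewrite subr_eq0 => /eqP.
apply: conn_vertices => t tF a b at_ bt; have [->//|ab] := eqVneq a b.
have dY : [set a; b]%SET \in triangulation_edges F.
  rewrite inE cards2 ab /=; apply/exists_inP; exists t => //.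
  by apply/fintype.subsetP => x; rewrite !inE => /orP[] /eqP ->.
pose d0 : Y := exist (fun d => is_true (d \in triangulation_edges F)) _ dY.
have := congr1 (fun z : {ffun Y -> 'F_2} => z d0) (edge_cobB F e1 e2).
rewrite ee subrr !ffunE /= big_setU1 ?inE //= big_set1 => /addF2_eq0.
by rewrite !ffunE.
Qed.

(** The 2-cycles mod 2: the kernel of the transposed incidence matrix of triangles and edges. *)
Definition dual_closed : {set {ffun X -> 'F_2}} := [set y : {ffun X -> 'F_2} |
  [forall d : Y, (\sum_(t : X) y t * (val d \subset val t)%:R == 0)%R]].

(** The two triangles at an edge get equal values. A connected link spreads this around a vertex,
    and connectedness of the surface to all triangles. *)
Lemma dual_closed_const (y : {ffun X -> 'F_2}) : y \in dual_closed -> exists c, y = [ffun=> c].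
Proof.
move=> yc; have [F3 Fv Fe Flink] := surf.
pose yF t : 'F_2 := if insub t is Some x then y x else 0.
have yFE (x : X) : y x = yF (val x) by rewrite /yF valK.
have edge_eq d t1 t2 : d \in triangulation_edges F -> t1 \in F -> t2 \in F ->
    d \subset t1 -> d \subset t2 -> yF t1 = yF t2.
  move=> dY t1F t2F dt1 dt2; have [->//|t12] := eqVneq t1 t2.
  pose d0 : Y := exist (fun d => is_true (d \in triangulation_edges F)) _ dY.
  have := yc; rewrite inE => /forallP/(_ d0)/eqP /= e.
  have dE : [set t in F | d \subset t]%SET = [set t1; t2]%SET.
    apply/esym/eqP; rewrite eqEcard Fe // cards2 t12 leqnn andbT.
    by apply/fintype.subsetP => t; rewrite !inE => /orP[] /eqP ->; rewrite ?t1F ?t2F.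
  apply: addF2_eq0; rewrite -{}[RHS]e.
  under eq_bigr do rewrite yFE.
  rewrite -(big_sub (mem F) (fun t : {set 'I_m} => yF t * (d \subset t)%:R)) /=.
  rewrite (eq_bigr (fun t : {set 'I_m} => if d \subset t then yF t else 0)) => [|t _]; last first.
    by case: ifP => _; rewrite ?mulr1 ?mulr0.
  rewrite -big_mkcondr /= (eq_bigl (mem [set t1; t2]%SET)); last first.
    by move=> t; rewrite -[RHS]/(t \in [set t1; t2]%SET) -dE inE.
  by rewrite big_setU1 ?inE //= big_set1.
have star_eq v t1 t2 : t1 \in F -> t2 \in F -> v \in t1 -> v \in t2 -> yF t1 = yF t2.
  move=> t1F t2F vt1 vt2.
  have third t : t \in F -> v \in t -> exists2 a, [set v; a]%SET \in triangulation_edges F &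
      [set v; a]%SET \subset t.
    move=> tF vt; have /card_gt0P[a] : (0 < #|t :\ v|)%N.
      by have := cardsD1 v t; rewrite vt F3 // add1n => -[<-].
    rewrite !inE => /andP[av at_]; exists a; last first.
      by apply/fintype.subsetP => x; rewrite !inE => /orP[] /eqP ->.
    rewrite inE cards2 (eq_sym v) av /=; apply/exists_inP; exists t => //.
    by apply/fintype.subsetP => x; rewrite !inE => /orP[] /eqP ->.
  have [a aE at1] := third _ t1F vt1; have [b bE bt2] := third _ t2F vt2.
  have /connectP[p] := Flink v a b aE bE.
  elim: p a t1 aE t1F vt1 at1 => [|c p IH] a t1 aE t1F vt1 at1 /=.
    by move=> _ ba; rewrite ba in bE bt2; exact: edge_eq aE _ _ at1 bt2.
  case/andP => /andP[ac acF] pc bl.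
  have sub1 : [set v; a]%SET \subset [set v; a; c]%SET by rewrite finset.subsetUl.
  have sub2 : [set v; c]%SET \subset [set v; a; c]%SET.
    by apply/fintype.subsetP => x; rewrite !inE => /orP[] ->; rewrite ?orbT.
  rewrite (edge_eq _ _ _ aE t1F acF at1 sub1).
  apply: (IH c) => //; last by rewrite !inE eqxx.
  rewrite inE; apply/andP; split; last by apply/exists_inP; exists [set v; a; c]%SET.
  rewrite cards2; case: (eqVneq v c) => // vc.
  have := F3 _ acF; rewrite -vc finset.setUC finset.setUA finset.setUid.
  by rewrite cards2; case: (_ != _).
pose eta v : 'F_2 := if [pick t in F | v \in t] is Some t then yF t else 0.
have etaE v t : t \in F -> v \in t -> eta v = yF t.
  move=> tF vt; rewrite /eta; case: pickP => [t' /andP[t'F vt']|/(_ t)]; last by rewrite tF vt.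
  exact: star_eq vt' vt.
have [t0 _|noX] := pickP (@predT X); last first.
  by exists 0; apply/ffunP => x; have := noX x.
exists (y t0); apply/ffunP => x; rewrite ffunE !yFE.
have ex_v (t : X) : exists v, v \in val t.
  by apply/card_gt0P; rewrite F3 // (valP t).
have [v vx] := ex_v x; have [w wt0] := ex_v t0.
rewrite -(etaE v) ?(valP x) // -(etaE w) ?(valP t0) //; apply: conn_vertices.
by move=> t tF i j it jt; rewrite (etaE i t) // (etaE j t).
Qed.

(** Duality and at most two 2-cycles give at most 2^(E - F + 1) closed cochains, against at least
    2^(m - 1) exact ones; the quotient is 2^g by the Euler relation. *)
Lemma card_closed_edges : (m + #|F| + g = #|triangulation_edges F| + 2)%N ->
  (#|closed_edges F| <= 2 ^ g * #|exact_edges F|)%N.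
Proof.
move=> euler.
have dual2 : (#|dual_closed| <= 2)%N.
  apply: (@leq_trans #|[set: 'F_2]|); last by rewrite cardsT card_ord.
  apply: leq_trans (leq_imset_card (fun c => [ffun=> c] : {ffun X -> 'F_2}) _).
  apply/subset_leq_card/fintype.subsetP => y /dual_closed_const[c ->].
  exact: imset_f.
have cX : #|{: X}| = #|F| by rewrite card_sig; apply: eq_card => t; rewrite !inE.
have cY : #|{: Y}| = #|triangulation_edges F|.
  by rewrite card_sig; apply: eq_card => d; rewrite !inE.
have := card_kernel_duality (fun (t : X) (d : Y) => (val d \subset val t)%:R).
rewrite cX cY -/dual_closed.
have -> : [set y : {ffun Y -> 'F_2} |
    [forall t : X, (\sum_(d : Y) (val d \subset val t)%:R * y d == 0)%R]]%SET = closed_edges F.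
  have sumE (y : {ffun Y -> 'F_2}) (t : {set 'I_m}) :
      \sum_(d : Y) (val d \subset t)%:R * y d = \sum_(d : Y | val d \subset t) y d.
    rewrite [RHS]big_mkcond; apply: eq_bigr => d _.
    by case: ifP => _; rewrite ?mul1r ?mul0r.
  apply/setP => y; rewrite !inE; apply/forallP/forall_inP => H t.
    by move=> tF; have := H (exist (fun t => is_true (t \in F)) _ tF); rewrite sumE.
  by rewrite sumE; apply: H; exact: valP.
move=> dual; have ex := card_exact_edges.
have pF : (0 < 2 ^ #|F|)%N by rewrite expn_gt0.
rewrite -(leq_pmul2r pF) dual.
apply: (@leq_trans (2 * 2 ^ #|triangulation_edges F|)%N); first by rewrite leq_mul2r dual2 orbT.
rewrite -(leq_pmul2r (isT : 0 < 2)%N).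
have -> : (2 * 2 ^ #|triangulation_edges F| * 2 = 2 ^ (m + #|F| + g))%N.
  by rewrite euler addn2 !expnS mulnC.
rewrite !expnD.
move: ex; move: (2 ^ m)%N (2 ^ #|F|)%N (2 ^ g)%N #|exact_edges F| => a b c x ax.
rewrite -mulnA (_ : c * x * b * 2 = (x * 2) * (b * c))%N; first exact: leq_mul.
by ring.
Qed.

End SurfaceCohomology.

(** * Branch sets *)

Lemma connU (W : finType) (adj : rel W) (X Y : {set W}) (w : W) :
  w \in X -> w \in Y -> conn adj X -> conn adj Y -> conn adj (X :|: Y).
Proof.
move=> wX wY cX cY eta ad.
have eX : {in X &, forall a b, eta a = eta b}.
  by apply: cX => a b aX bX; apply: ad; rewrite inE ?aX ?bX.
have eY : {in Y &, forall a b, eta a = eta b}.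
  by apply: cY => a b aX bX; apply: ad; rewrite inE ?aX ?bX orbT.
have ew a : a \in X :|: Y -> eta a = eta w.
  by rewrite inE => /orP[aX|aY]; [exact: eX|exact: eY].
by move=> a b /ew -> /ew ->.
Qed.

Section BranchSets.
Variables (W V : finType) (adj : rel W) (D : {set V * V}).
Variables (KB : V -> {set W}) (MB : V * V -> {set W}).
Hypothesis adj_sym : symmetric adj.
Hypothesis KB_conn : forall v, conn adj (KB v).
Hypothesis MB_conn : {in D, forall a, conn adj (MB a)}.
Hypothesis KB_disj : forall u v, u != v -> [disjoint KB u & KB v].
Hypothesis MB_disj : {in D &, forall a b, a != b -> [disjoint MB a & MB b]}.
Hypothesis MB_KB_disj : {in D, forall a v, v != a.1 -> v != a.2 -> [disjoint MB a & KB v]}.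
Hypothesis MB_fst : {in D, forall a, exists2 w, w \in MB a & w \in KB a.1}.
Hypothesis MB_snd : {in D, forall a, exists2 w, w \in MB a & w \in KB a.2}.
Hypothesis D_neq : {in D, forall a, a.1 != a.2}.

Let U a := (KB a.1 :|: MB a) :\: KB a.2.
Let step a : rel W := fun x y => [&& adj x y, x \in U a & y \in U a].
Let reach a := [set w in U a | [exists x in KB a.1, connect (step a) x w]].
(* The blob of each arc is divided where it is first left for the second endpoint. *)
Definition branch v : {set W} := KB v :|: \bigcup_(a in D | a.1 == v) reach a.

Let notin_disj (X Y : {set W}) w : [disjoint X & Y] -> w \in X -> w \notin Y.
Proof. by move=> d wX; rewrite (disjointFr d wX). Qed.

Let KB_U a w : a \in D -> w \in KB a.1 -> w \in U a.
Proof. by move=> aD wK; rewrite !inE wK andbT (notin_disj (KB_disj (D_neq aD))). Qed.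

Let KB_reach a w : a \in D -> w \in KB a.1 -> w \in reach a.
Proof. by move=> aD wK; rewrite inE KB_U //=; apply/exists_inP; exists w. Qed.

(** The union of [KB a.1] and [MB a] is connected and meets [KB a.2]. Without an exit, the indicator
    of [reach a] would be locally constant on it, yet it is 1 at [w1] and 0 at [w2]. *)
Lemma ex_exit a : a \in D -> exists p : W * W, [/\ p.1 \in reach a, p.2 \in KB a.2 & adj p.1 p.2].
Proof.
move=> aD; have [w1 w1M w1K] := MB_fst aD; have [w2 w2M w2K] := MB_snd aD.
case: (boolP [exists x in reach a, exists y in KB a.2, adj x y]) => [|noexit].
  by case/exists_inP => x xr /exists_inP[y yK xy]; exists (x, y).
have c := connU w1K w1M (@KB_conn a.1) (@MB_conn a aD).
pose eta w : 'F_2 := (w \in reach a)%:R.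
have closed x y : x \in KB a.1 :|: MB a -> y \in KB a.1 :|: MB a -> adj x y ->
    x \in reach a -> y \in reach a.
  move=> xX yX xy xr; have yN : y \notin KB a.2.
    apply/negP => yK; move/negP: noexit; apply.
    by apply/exists_inP; exists x => //; apply/exists_inP; exists y.
  have yU : y \in U a by rewrite /U finset.in_setD yN.
  have := xr; rewrite inE => /andP[xU /exists_inP[z zK zx]].
  rewrite inE yU /=; apply/exists_inP; exists z => //.
  by apply: connect_trans zx (connect1 _); rewrite /step xy xU.
have : eta w1 = eta w2.
  apply: c; [|by rewrite inE w1K|by rewrite inE w2M orbT].
  move=> x y xX yX xy; congr (_%:R); congr nat_of_bool; apply/idP/idP; apply: closed => //.
  by rewrite adj_sym.
rewrite /eta KB_reach // (_ : (w2 \in reach a) = false) //.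
by rewrite !inE w2K.
Qed.

Lemma branch_conn v : conn adj (branch v).
Proof.
move=> eta ad.
have KBb : {subset KB v <= branch v} by move=> w wK; rewrite inE wK.
have eK : {in KB v &, forall x y, eta x = eta y}.
  by apply: KB_conn => x y xK yK; apply: ad; apply: KBb.
have toK w : w \in branch v -> exists2 x, x \in KB v & eta w = eta x.
  rewrite inE => /orP[wK|]; first by exists w.
  case/bigcupP => a /andP[aD /eqP av]; rewrite inE => /andP[_ /exists_inP[x xK]].
  rewrite av in xK => /connectP[p pp ->]; exists x => //.
  have rb : {subset reach a <= branch v}.
    by move=> z zr; rewrite inE; apply/orP; right; apply/bigcupP; exists a; rewrite ?aD ?av ?eqxx.
  have : x \in reach a by apply: KB_reach; rewrite ?av.
  elim: p x {xK} pp => //= y p IH x /andP[xy pp] xr.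
  have yr : y \in reach a.
    have := xr; rewrite inE => /andP[xU /exists_inP[z zK zx]].
    have /and3P[_ _ yU] := xy.
    rewrite inE yU; apply/exists_inP; exists z => //.
    exact: connect_trans zx (connect1 xy).
  rewrite (IH y) //; apply/esym/ad; rewrite ?rb //; by case/and3P: xy.
by move=> x y /toK[x' x'K ->] /toK[y' y'K ->]; exact: eK.
Qed.

(** The blob of an arc does meet that of its second endpoint; removing [KB a.2] in [U a] restores
    disjointness. *)
Lemma branch_disj u v : u != v -> [disjoint branch u & branch v].
Proof.
move=> uv.
have KR x y a w : x != y -> a \in D -> a.1 = y -> w \in KB x -> w \notin reach a.
  move=> xy aD ay wK; rewrite !inE negb_and; apply/orP; left.
  rewrite negb_and negbK; case: (eqVneq x a.2) => [<-|xa2]; first by rewrite wK.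
  rewrite negb_or; apply/orP; right; apply/andP; split.
    by apply: notin_disj wK; apply: KB_disj; rewrite ay.
  apply/negP => wM; have := MB_KB_disj aD (_ : x != a.1) xa2; rewrite ay => /(_ xy) d.
  by have := notin_disj d wM; rewrite wK.
rewrite disjoint_subset; apply/fintype.subsetP => w; rewrite !inE => wu.
apply/negP => wv; case/orP: wu => [wu|/bigcupP[a /andP[aD /eqP au] wa]].
  case/orP: wv => [wv|/bigcupP[b /andP[bD /eqP bv] wb]].
    by have := notin_disj (KB_disj uv) wu; rewrite wv.
  by have := KR _ _ _ _ uv bD bv wu; rewrite wb.
case/orP: wv => [wv|/bigcupP[b /andP[bD /eqP bv] wb]].
  by have := KR v u a w; rewrite eq_sym wa => /(_ uv aD au wv).
have ab : a != b by apply: contraNneq uv => e; rewrite -au -bv e.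
have := wa; rewrite !inE => /andP[/andP[_ /orP[wK|wM]] _].
  by rewrite au in wK; have := KR u v b w uv bD bv wK; rewrite wb.
have := wb; rewrite !inE => /andP[/andP[_ /orP[wK|wM']] _].
  by rewrite bv in wK; have := KR v u a w; rewrite eq_sym wa => /(_ uv aD au wK).
by have := notin_disj (MB_disj aD bD ab) wM; rewrite wM'.
Qed.

Lemma ex_minor (w0 : W) : exists ed : V * V -> W * W,
  {in D, forall a, ((ed a).1 \in branch a.1 /\ (ed a).2 \in branch a.2) /\ adj (ed a).1 (ed a).2}.
Proof.
have exE a : exists p : W * W, a \in D ->
    [/\ p.1 \in reach a, p.2 \in KB a.2 & adj p.1 p.2].
  case: (boolP (a \in D)) => [aD|aN].
    by have [p pP] := ex_exit aD; exists p.
  by exists (w0, w0).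
have [ed edP] := boolp.choice exE; exists ed => a aD.
have [h1 h2 h3] := edP a aD; do 2!split=> //; rewrite inE ?h2 //.
by apply/orP; right; apply/bigcupP; exists a; rewrite ?aD ?eqxx.
Qed.
End BranchSets.

(** * Approximation of subsets of the realization by lattice points *)

Section Topology.
Local Open Scope classical_set_scope.

(** The bridge from topology to ['F_2]-valued functions: compatible labels on an open cover form a
    locally constant function on [C], whose level sets are open and closed. *)
Lemma connected_label (T : topologicalType) (C : set T) (I : Type) (O : I -> set T)
    (h : I -> 'F_2) : connected C -> (forall i, open (O i)) ->
  (forall x, C x -> exists i, O i x) ->
  (forall x i j, C x -> O i x -> O j x -> h i = h j) ->
  forall i j x y, C x -> C y -> O i x -> O j y -> h i = h j.
Proof.
move=> cC oO cov comp i j x y Cx Cy ix jy.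
pose A b := \bigcup_(k in [set k | (h k == h i) = b]) O k.
have oA b : open (A b) by apply: bigcup_open => k _; exact: oO.
have AE : C `&` A true = C.
  apply: cC.
  - by exists x; split => //; exists i => //=; rewrite eqxx.
  - by exists (A true).
  - exists (~` A false); first exact: open_closedC.
    apply/seteqP; split => z [Cz].
      move=> [k /= hk kz]; split => // -[l /= hl lz].
      by rewrite (comp z l k Cz lz kz) hk in hl.
    move=> nz; split => //; have [k kz] := cov z Cz; exists k => //=.
    by apply/negPn/negP => /negbTE hk; apply: nz; exists k.
have : (C `&` A true) y by rewrite AE.
by case=> _ [k /= /eqP hk ky]; rewrite -hk; apply: comp Cy ky jy.
Qed.

Section Realization.
Variables (R : realType) (m : nat) (F : {set {set 'I_m}}).

(** The open stars of the vertices cover the realization, and two stars meet only if their vertices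
    share a triangle. *)
Lemma connected_realization_vertices : connected (@realization R m F) ->
  (forall v : 'I_m, exists2 t, t \in F & v \in t) ->
  forall eta : 'I_m -> 'F_2,
  {in F, forall t : {set 'I_m}, {in t &, forall i j, eta i = eta j}} -> forall i j, eta i = eta j.
Proof.
move=> cF Fv eta etaF i j.
pose vtx (i : 'I_m) : 'rV[R]_m := \row_k (k == i)%:R.
have vF k : realization F (vtx k).
  split=> [l||].
  - by rewrite mxE ler0n.
  - rewrite (bigD1 k) //= mxE eqxx big1 ?addr0 // => l lk.
    by rewrite mxE (negbTE lk).
  - have [t tF kt] := Fv k; exists t => // l; rewrite mxE.
    by case: (eqVneq l k) => [->//|_]; rewrite eqxx.
apply: (@connected_label _ _ _ (fun k => [set x : 'rV[R]_m | x ord0 k != 0]) eta cF _ _ _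
   i j (vtx i) (vtx j)); rewrite ?vF //=; last 2 first.
- by rewrite mxE eqxx oner_eq0.
- by rewrite mxE eqxx oner_eq0.
- move=> k; apply: (@open_comp _ _ (fun x : 'rV[R]_m => x ord0 k) [set y | y != 0]).
    by move=> x _; exact: coord_continuous.
  exact: open_neq.
- move=> x [_ x1 _]; apply: contrapT => /forallNP nx; have := x1; rewrite big1.
    by move/esym/eqP; rewrite oner_eq0.
  by move=> k _; apply/eqP/negPn/negP => /(nx k).
- by move=> x k l [_ _ [t tF xt]] /xt kt /xt lt; apply: etaF kt lt.
Qed.

Section Blob.
Variable N : nat.
Notation W := {ffun 'I_m -> 'I_N.+1}.

Definition in_blob (x : 'rV[R]_m) (a : W) : Prop :=
  (\sum_i a i = N)%N /\ forall i, `|N%:R * x ord0 i - (a i)%:R| < 1.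

(* Rounding the partial sums of N x down keeps every coordinate within distance 1. *)
Lemma blob_nonempty x : realization F x -> exists a, in_blob x a.
Proof.
move=> [x0 x1 _].
pose s k : R := \sum_(i < m | (i < k)%N) N%:R * x ord0 i.
have s_ge0 k : 0 <= s k by apply: sumr_ge0 => i _; rewrite mulr_ge0 ?ler0n.
have sS (i : 'I_m) : s i.+1 = s i + N%:R * x ord0 i.
  rewrite /s (bigD1 i) //= addrC; congr (_ + _); apply: eq_bigl => k.
  by rewrite ltnS [in RHS]ltn_neqAle andbC.
have s_m : s m = N%:R.
  rewrite /s (eq_bigl xpredT) => [|i]; last by rewrite ltn_ord.
  by rewrite -mulr_sumr x1 mulr1.
have s_0 : s 0%N = 0 by rewrite /s big_pred0.
pose T k := Num.truncn (s k).
have Tmono k : (k < m)%N -> (T k <= T k.+1)%N.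
  move=> km; apply: le_truncn; have -> : s k.+1 = s k + N%:R * x ord0 (Ordinal km) by rewrite (sS (Ordinal km)).
  by rewrite lerDl mulr_ge0 ?ler0n.
have T0 : T 0%N = 0%N by rewrite /T s_0 truncn0.
have Tm : T m = N by rewrite /T s_m natrK.
pose b (i : 'I_m) := (T i.+1 - T i)%N.
have b_sum : (\sum_i b i = N)%N.
  rewrite -(big_mkord xpredT (fun i => T i.+1 - T i)%N).
  by rewrite telescope_sumn_in // ?Tm ?T0 ?subn0 // => i /andP[_ im]; apply: Tmono.
have b_le i : (b i <= N)%N by rewrite -[leqRHS]b_sum (bigD1 i) //= leq_addr.
exists [ffun i => inord (b i)]; split.
  by rewrite -[RHS]b_sum; apply: eq_bigr => i _; rewrite ffunE inordK // ltnS.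
move=> i; rewrite ffunE inordK ?ltnS // /b natrB ?Tmono //.
have /andP[l1 u1] := truncn_itv (s_ge0 i.+1).
have /andP[l2 u2] := truncn_itv (s_ge0 i).
rewrite -/(T _) in l1 u1; rewrite -/(T _) in l2 u2.
rewrite sS in l1 u1; rewrite -natr1 in u1; rewrite -natr1 in u2.
rewrite ltr_norml; lra.
Qed.

Lemma blob_lat x a (t : {set 'I_m}) : in_blob x a -> (forall i, x ord0 i != 0 -> i \in t) -> lat t a.
Proof.
move=> [sa xa] xt; rewrite /lat sa eqxx /=; apply/forallP => i; apply/implyP => ai.
apply: xt; apply: contraNneq ai => xi; have := xa i; rewrite xi mulr0 sub0r normrN normr_nat.
by rewrite -[1]/(1%:R) ltr_nat ltnS leqn0.
Qed.

Lemma blob_near x a b : in_blob x a -> in_blob x b -> nearby a b.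
Proof.
move=> [_ xa] [_ xb]; apply/forallP => i; have := xa i; have := xb i.
rewrite !ltr_norml => /andP[b1 b2] /andP[a1 a2].
have l (p q : nat) : p%:R < q%:R + 2%:R :> R -> (p <= q.+1)%N.
  by rewrite -natrD ltr_nat addn2 ltnS.
by apply/andP; split; apply: l; lra.
Qed.

(* So the lattice points around x form a clique, and the blob of a connected set is
   connected. *)
Lemma blob_adj x a b : realization F x -> in_blob x a -> in_blob x b -> a != b -> gadj F a b.
Proof.
move=> [_ _ [t tF xt]] xa xb ab; rewrite /gadj ab (blob_near xa xb) /=.
by apply/exists_inP; exists t; rewrite // (blob_lat xa xt) (blob_lat xb xt).
Qed.

Lemma blob_open a : open [set x | in_blob x a].
Proof.
have [sa|sa] := pselect ((\sum_i a i = N)%N); last first.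
  have -> : [set x | in_blob x a] = set0 by apply/seteqP; split => x //= [].
  exact: open0.
have -> : [set x | in_blob x a] =
    [set x : 'rV[R]_m | forall i, `|N%:R * x ord0 i - (a i)%:R| < 1].
  by apply/seteqP; split => x /=; [case|].
rewrite openE => x /= xa; rewrite /interior /=.
apply: (@filter_forall _ _ (fun i => [set y : 'rV[R]_m | `|N%:R * y ord0 i - (a i)%:R| < 1])
  (nbhs x)) => i.
have c : {for x, continuous (fun y : 'rV[R]_m => `|N%:R * y ord0 i - (a i)%:R|)}.
  apply: (@continuous_comp _ _ _ (fun y : 'rV[R]_m => N%:R * y ord0 i - (a i)%:R) Num.norm).
    apply: continuousB; last exact: cst_continuous.
    by apply: continuousM; [exact: cst_continuous|exact: coord_continuous].
  exact: norm_continuous.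
exact: (cvgr_lt _ c _ (xa i)).
Qed.

Definition blob (C : set 'rV[R]_m) : {set W} := [set a : W | `[< exists2 x, C x & in_blob x a >]].

Lemma blobP C a : reflect (exists2 x, C x & in_blob x a) (a \in blob C).
Proof. by rewrite inE; exact: asboolP. Qed.

Lemma blob_conn C : connected C -> C `<=` @realization R m F -> conn (@gadj m N F) (blob C).
Proof.
move=> cC CF eta ad a b /blobP[x Cx xa] /blobP[y Cy yb].
apply: (@connected_label _ _ _ (fun a => [set x | in_blob x a]) eta cC blob_open _ _ a b x y) => //.
  by move=> z /CF /blob_nonempty.
move=> z c d Cz zc zd; have [->//|cd] := eqVneq c d.
by apply: ad; [apply/blobP; exists z..|exact: blob_adj (CF _ Cz) zc zd cd].
Qed.

End Blob.

(** A common lattice point would put points of [K] and [K'] within 2/N of each other in every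
    coordinate, which disjoint compact sets forbid for large N. *)
Lemma blob_separation (K K' : set 'rV[R]_m) : compact K -> compact K' -> K `&` K' = set0 ->
  \forall N \near \oo, disjoint (mem (blob N K)) (mem (blob N K')).
Proof.
move=> cK cK' KK'.
have clK' : closed K' by apply: compact_closed => //; exact: norm_hausdorff.
have sep : \forall N \near \oo, K `<=` [set x | forall y a, K' y -> @in_blob N x a -> ~ @in_blob N y a].
  apply: (compact_near_coveringP _).1 cK _ _ _ _ _ => x Kx.
  have : nbhs x (~` K').
    apply: open_nbhs_nbhs; split; first exact: closed_openC.
    by move=> K'x; have : (K `&` K') x by []; rewrite KK'.
  move=> /nbhs_ballP[d /= d0 dK'].
  (* Half of [d] is for moving [x] to [x'], the other half for 2/N; hence the threshold 4/d. *)
  exists (ball x (d / 2), [set N | 4 / d < N%:R]).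
    split; first by apply: nbhsx_ballx; rewrite divr_gt0.
    exact: nbhs_infty_gtr.
  move=> [x' N] /= [xx' Nd] y a K'y [_ x'a] [_ ya]; apply: (dK' y) K'y; split=> // i j.
  have := xx'.2 i j; rewrite /ball /= (ord1 i) => h.
  have N0 : 0 < N%:R :> R by apply: lt_trans Nd; rewrite divr_gt0.
  have {}Nd : 4 < d * N%:R by move: Nd; rewrite ltr_pdivrMr // mulrC.
  have := x'a j; have := ya j.
  rewrite !ltr_norml in h *; case/andP: h => h1 h2 /andP[y1 y2] /andP[x1 x2].
  have e1 : (x ord0 j - x' ord0 j) * N%:R < d / 2 * N%:R by rewrite ltr_pM2r.
  have e2 : - (d / 2) * N%:R < (x ord0 j - x' ord0 j) * N%:R by rewrite ltr_pM2r.
  have e3 : (x ord0 j - y ord0 j) * N%:R < d * N%:R by lra.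
  have e4 : - d * N%:R < (x ord0 j - y ord0 j) * N%:R by lra.
  by move: e3 e4; rewrite !ltr_pM2r // => -> ->.
apply: filterS sep => N KN; rewrite disjoint_subset; apply/fintype.subsetP => a /blobP[x Kx xa].
by rewrite !inE; apply/asboolPn => -[y K'y ya]; exact: KN Kx y a K'y xa ya.
Qed.

End Realization.
End Topology.

(** * Embedded graphs *)

Lemma thirds_apart (R : realFieldType) (t : R) : 2 / 3 <= t -> t <= 1 / 3 -> False.
Proof. by move=> *; lra. Qed.

Section EmbeddedGraph.
Local Open Scope classical_set_scope.
Local Open Scope ring_scope.
Variables (R : realType) (S : topologicalType) (V : finType) (e : rel V).
Variables (p : V -> S) (gamma : {set V} -> R -> S) (D : {set V * V}).
Hypotheses (e_sym : symmetric e) (e_irr : irreflexive e).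
Hypothesis G_in_S : embedding e p gamma.
Hypothesis oD : is_orientation e D.

Let seg_of (a : V * V) : {set V} := [set a.1; a.2]%SET.

Lemma orientation_edge a : a \in D -> e a.1 a.2.
Proof.
by case: a => u v; have := forallP (forallP oD u) v; case: (e u v) => // /negbTE ->.
Qed.

Let De a : a \in D -> seg_of a \in edges e.
Proof. by move=> aD; apply/imsetP; exists a; rewrite ?inE ?orientation_edge. Qed.

Let seg_inj a b : a \in D -> b \in D -> seg_of a = seg_of b -> a = b.
Proof.
move=> aD bD ab; have : a.1 \in seg_of b by rewrite -ab !inE eqxx.
have : a.2 \in seg_of b by rewrite -ab !inE eqxx orbT.
have ne (x : V * V) : x \in D -> x.1 != x.2.
  by move=> /orientation_edge xe; apply/eqP => x12; rewrite x12 e_irr in xe.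
have na := ne a aD; rewrite !inE => /orP[] /eqP e2 /orP[] /eqP e1;
  try by rewrite e1 e2 eqxx in na.
- have := forallP (forallP oD b.1) b.2; rewrite -surjective_pairing bD.
  rewrite -{2}e1 -{2}e2 -surjective_pairing aD /=.
  by case: (e _ _).
- by rewrite [a]surjective_pairing [b]surjective_pairing e1 e2.
Qed.

(* Each arc is cut into thirds; star v collects the outer thirds at v. *)
Let end_near (a : V * V) (b : bool) : set S :=
  gamma (seg_of a) @` (if b then `[2 / 3, 1] else `[0, 1 / 3])%classic.

Definition middle (a : V * V) : set S := gamma (seg_of a) @` `[1 / 3, 2 / 3]%classic.

(** [None] stands for the vertex itself, so that an isolated vertex has a star. The direction of
    [gamma] is not prescribed, so the parameter 0 or 1 at [v] is read off from the values. *)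
Let at_end v : pred (option ((V * V) * bool)) := fun o =>
  if o is Some (a, b) then (a \in D) && `[< gamma (seg_of a) b%:R = p v >] else true.

Let star_piece v (o : option ((V * V) * bool)) : set S :=
  if o is Some (a, b) then end_near a b else [set p v].

Definition star v : set S := \bigcup_(o in [set` at_end v]) star_piece v o.

Let arc_cont a : a \in D -> {within `[0, 1], continuous (gamma (seg_of a))}.
Proof. by move=> aD; have [_ /(_ _ _ (orientation_edge aD))[] ] := G_in_S. Qed.

Let sub_cont a lo hi : a \in D -> 0 <= lo -> hi <= 1 ->
  {within `[lo, hi], continuous (gamma (seg_of a))}.
Proof.
move=> aD lo0 hi1; apply: continuous_subspaceW (arc_cont aD) => t /=.
by rewrite !in_itv /= => /andP[t1 t2]; apply/andP; split; lra.
Qed.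

Let third_itv (b : bool) : exists lo hi : R, [/\ 0 <= lo, hi <= 1 &
   (if b then `[2 / 3, 1] else `[0, 1 / 3])%classic = `[lo, hi]%classic].
Proof. by case: b; [exists (2 / 3), 1|exists 0, (1 / 3)]; split => //; lra. Qed.

Lemma middle_compact a : a \in D -> compact (middle a).
Proof.
by move=> aD; apply: continuous_compact; [apply: sub_cont => //; lra|exact: segment_compact].
Qed.

Lemma middle_connected a : a \in D -> connected (middle a).
Proof.
move=> aD; apply: connected_continuous_connected; first exact: segment_connected.
by apply: sub_cont => //; lra.
Qed.

Lemma star_compact v : compact (star v).
Proof.
rewrite /star bigcup_pred; apply: bigsetU_compact => -[[a b]|] /=; last first.
  by move=> _; exact: compact_set1.
rewrite /in_mem /= => /andP[aD _]; rewrite /end_near; have [lo [hi [l0 h1 ->]]] := third_itv b.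
by apply: continuous_compact; [exact: sub_cont|exact: segment_compact].
Qed.

Lemma star_connected v : connected (star v).
Proof.
apply: bigcup_connected.
  exists (p v) => -[[a b]|] //= /andP[_ /asboolP <-]; exists b%:R => //.
  by case: b => /=; rewrite in_itv /=; apply/andP; split; lra.
move=> [[a b]|] /=; last by move=> _; exact: connected1.
move=> /andP[aD _]; rewrite /end_near; have [lo [hi [l0 h1 ->]]] := third_itv b.
by apply: connected_continuous_connected; [exact: segment_connected|exact: sub_cont].
Qed.

Lemma starP v z : star v z -> z = p v \/ exists a (b : bool) t, [/\ a \in D,
  gamma (seg_of a) b%:R = p v, t \in `]0, 1[, z = gamma (seg_of a) t &
  if b then 2 / 3 <= t else t <= 1 / 3].
Proof.
move=> [[[a b]|] /=]; last by move=> _ ->; left.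
move=> /andP[aD /asboolP av] [t tI <-].
case: b av tI => av; rewrite /= in_itv /= => /andP[t1 t2].
  case: (eqVneq t 1) => [->|tN]; first by left.
  right; exists a, true, t; split => //; rewrite in_itv /=.
  by apply/andP; split; [lra|rewrite lt_neqAle tN].
case: (eqVneq t 0) => [->|tN]; first by left.
right; exists a, false, t; split => //; rewrite in_itv /=.
by apply/andP; split; [rewrite lt_neqAle eq_sym tN|lra].
Qed.

Lemma middleP a z : middle a z -> exists t, (t \in `]0, 1[) /\ z = gamma (seg_of a) t.
Proof.
move=> [t + <-]; rewrite /= in_itv /= => /andP[t1 t2]; exists t; split => //.
by rewrite in_itv /=; apply/andP; split; lra.
Qed.

Let int_end a t v : a \in D -> t \in `]0, 1[ -> gamma (seg_of a) t <> p v.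
Proof. by move=> aD tI; have [_ _ H _] := G_in_S; apply: H => //; apply: De. Qed.

Let int_arc a b t t' : a \in D -> b \in D -> t \in `]0, 1[ -> t' \in `]0, 1[ ->
  gamma (seg_of a) t = gamma (seg_of b) t' -> a = b /\ t = t'.
Proof.
move=> aD bD tI t'I E; have [_ H _ U] := G_in_S.
have ab : a = b by apply: seg_inj => //; apply: U tI t'I E; apply: De.
split=> //; have [_ inj _] := H _ _ (orientation_edge aD).
move: E; rewrite -ab => E; apply: inj E.
  by move: tI; rewrite !in_itv /= => /andP[t1 t2]; rewrite !ltW.
by move: t'I; rewrite !in_itv /= => /andP[t1 t2]; rewrite !ltW.
Qed.

Lemma star_disjoint u v : u != v -> star u `&` star v = set0.
Proof.
move=> uv; have [p_inj _ _ _] := G_in_S.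
have puv : p u <> p v by move/p_inj/eqP; rewrite (negbTE uv).
apply/seteqP; split => // z [/starP zu /starP zv].
case: zu => [zu|[a [b [t [aD au tI zt bt]]]]]; case: zv => [zv|[a' [b' [t' [aD' av tI' zt' bt']]]]].
- by apply: puv; rewrite -zu -zv.
- by apply: (int_end (v := u) aD' tI'); rewrite -zt' zu.
- by apply: (int_end (v := v) aD tI); rewrite -zt zv.
- have [aa tt] := int_arc aD aD' tI tI' (etrans (esym zt) zt'); subst a' t'.
  have bb : b = b' by case: b b' bt bt' {au av} => -[] // h1 h2; exfalso; first [exact: thirds_apart h1 h2|exact: thirds_apart h2 h1].
  by apply: puv; rewrite -au -av bb.
Qed.

Lemma middle_disjoint a b : a \in D -> b \in D -> a != b -> middle a `&` middle b = set0.
Proof.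
move=> aD bD ab; apply/seteqP; split => // z [/middleP[t [tI zt]] /middleP[t' [t'I zt']]].
by have [E _] := int_arc aD bD tI t'I (etrans (esym zt) zt'); rewrite E eqxx in ab.
Qed.

Lemma end_of_edge a (b : bool) v : a \in D -> gamma (seg_of a) b%:R = p v -> v = a.1 \/ v = a.2.
Proof.
move=> aD av; have [p_inj /(_ _ _ (orientation_edge aD))[_ _ E] _ _] := G_in_S.
have : [set p a.1; p a.2] (p v) by rewrite -E -av; case: b {av}; [right|left].
by case=> /p_inj ->; [left|right].
Qed.

Lemma middle_star_disjoint a v : a \in D -> v != a.1 -> v != a.2 -> middle a `&` star v = set0.
Proof.
move=> aD v1 v2; apply/seteqP; split => // z [/middleP[t [tI zt]] /starP[zv|]].
  by apply: (int_end (v := v) aD tI); rewrite -zt zv.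
move=> [b [c [t' [bD bv t'I zt' _]]]].
have [E _] := int_arc aD bD tI t'I (etrans (esym zt) zt'); subst b.
by case: (end_of_edge aD bv) => E; [move: v1|move: v2]; rewrite E eqxx.
Qed.

Lemma middle_star a v : a \in D -> v = a.1 \/ v = a.2 -> exists z, middle a z /\ star v z.
Proof.
move=> aD va; have [_ /(_ _ _ (orientation_edge aD))[_ _ E] _ _] := G_in_S.
have [b bv] : exists b : bool, gamma (seg_of a) b%:R = p v.
  have : [set p a.1; p a.2] (p v) by case: va => ->; [left|right].
  by rewrite -E => -[->|->]; [exists false|exists true].
exists (gamma (seg_of a) (if b then 2 / 3 else 1 / 3)); split.
  by exists (if b then 2 / 3 else 1 / 3) => //=; rewrite in_itv /=; case: b {bv}; apply/andP; split; lra.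
exists (Some (a, b)); first by apply/andP; split => //; exact/asboolP.
exists (if b then 2 / 3 else 1 / 3) => //.
by case: b {bv} => /=; rewrite in_itv /=; apply/andP; split; lra.
Qed.

Variable g : nat.
Hypothesis girth5 : girth_ge e 5.
Hypothesis S_conn : connected [set: S].
Hypothesis S_genus : Euler_genus R S g.

Lemma embedded_card_le r :
  (#|coboundary_on D @: [set: {ffun V -> 'F_2}]%SET| <= 2 ^ r)%N -> (3 * #|D| <= 5 * (r + g))%N.
Proof.
(* The arc [a0] serves to produce a lattice point [w0], the default value in [ex_minor]. *)
move=> card_cob; case: (set_0Vmem D) => [->|[a0 a0D]]; first by rewrite cards0.
have [m [F [surf [f [h [[cf _] [fF hS] fK hK]]] euler]]] := S_genus.
have [F3 Fv Fedge _] := surf.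
have f_inj : injective f by move=> x y fxy; rewrite -(fK x) // -(fK y) // fxy.
have cfA A : {within A, continuous f} by exact: continuous_subspaceW cf.
have f_disj A B : A `&` B = set0 -> (f @` A) `&` (f @` B) = set0.
  move=> AB; apply/seteqP; split => // _ [[x Ax <-] [y By /f_inj yx]].
  by suff : set0 x by []; rewrite -AB; split => //; rewrite -yx.
have f_sub A : f @` A `<=` realization F by move=> _ [x _ <-]; exact: fF.
have F_conn : connected (@realization R m F).
  have -> : realization F = f @` [set: S].
    apply/seteqP; split => [x Fx|]; last exact: f_sub.
    by exists (h x) => //; exact: hK.
  exact: connected_continuous_connected.
have conn_vertices := connected_realization_vertices F_conn Fv.
pose K v := f @` star v; pose M a := f @` middle a.
have cK v : compact (K v) by apply: continuous_compact => //; exact: star_compact.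
have cM a : a \in D -> compact (M a).
  by move=> aD; apply: continuous_compact => //; exact: middle_compact.
have sepK : \forall N \near \oo, forall uv : V * V, uv.1 != uv.2 ->
    disjoint (mem (blob N (K uv.1))) (mem (blob N (K uv.2))).
  apply: (@filter_forall _ _ (fun uv => [set N | uv.1 != uv.2 ->
     disjoint (mem (blob N (K uv.1))) (mem (blob N (K uv.2)))])) => uv.
  have [->|uvN] := eqVneq uv.1 uv.2; first by near=> N.
  by apply: filterS (blob_separation (cK _) (cK _) (f_disj _ _ (star_disjoint uvN))) => N dN _.
have sepM : \forall N \near \oo, forall ab : (V * V) * (V * V),
    [&& ab.1 \in D, ab.2 \in D & ab.1 != ab.2] ->
    disjoint (mem (blob N (M ab.1))) (mem (blob N (M ab.2))).
  apply: (@filter_forall _ _ (fun ab => [set N | [&& ab.1 \in D, ab.2 \in D & ab.1 != ab.2] ->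
     disjoint (mem (blob N (M ab.1))) (mem (blob N (M ab.2)))])) => ab.
  case: (boolP [&& _, _ & _]) => [/and3P[aD bD abN]|_]; last by near=> N.
  by apply: filterS (blob_separation (cM _ aD) (cM _ bD) (f_disj _ _ (middle_disjoint aD bD abN))) => N dN _.
have sepMK : \forall N \near \oo, forall av : (V * V) * V,
    [&& av.1 \in D, av.2 != av.1.1 & av.2 != av.1.2] ->
    disjoint (mem (blob N (M av.1))) (mem (blob N (K av.2))).
  apply: (@filter_forall _ _ (fun av => [set N | [&& av.1 \in D, av.2 != av.1.1 & av.2 != av.1.2] ->
     disjoint (mem (blob N (M av.1))) (mem (blob N (K av.2)))])) => av.
  case: (boolP [&& _, _ & _]) => [/and3P[aD v1 v2]|_]; last by near=> N.
  by apply: filterS (blob_separation (cM _ aD) (cK _) (f_disj _ _ (middle_star_disjoint aD v1 v2))) => N dN _.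
(* Finitely many separations hold for all large N, so one positive N serves them all. *)
have [N [[[N0 HK] HM] HMK]] := filter_ex (filterI (filterI (filterI (nbhs_infty_gt 0) sepK) sepM) sepMK).
pose KB v := blob N (K v); pose MB a := blob N (M a).
have adj_sym : symmetric (@gadj m N F).
  move=> a b; rewrite /gadj eq_sym near_sym; congr [&& _, _ & _].
  by apply: eq_existsb => t; rewrite [lat t a && _]andbC.
have KB_conn v : conn (@gadj m N F) (KB v).
  apply: (blob_conn _ (f_sub _)); apply: connected_continuous_connected => //.
  exact: star_connected.
have MB_conn : {in D, forall a, conn (@gadj m N F) (MB a)}.
  move=> a aD; apply: (blob_conn _ (f_sub _)).
  apply: connected_continuous_connected => //.
  exact: middle_connected.
have meet a v : a \in D -> v = a.1 \/ v = a.2 -> exists2 w, w \in MB a & w \in KB v.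
  move=> aD va; have [z [Mz Kz]] := middle_star aD va.
  have [w wz] := blob_nonempty N (fF z I).
  by exists w; apply/blobP; exists (f z) => //; exists z.
have KB_disj u v : u != v -> disjoint (mem (KB u)) (mem (KB v)) by move=> uv; apply: (HK (u, v)).
have MB_disj : {in D &, forall a b, a != b -> disjoint (mem (MB a)) (mem (MB b))}.
  by move=> a b aD bD ab; apply: (HM (a, b)); rewrite /= aD bD.
have MB_KB_disj : {in D, forall a v, v != a.1 -> v != a.2 -> disjoint (mem (MB a)) (mem (KB v))}.
  by move=> a aD v v1 v2; apply: (HMK (a, v)); rewrite /= aD v1.
have D_neq : {in D, forall a, a.1 != a.2}.
  by move=> a /orientation_edge ae; apply/eqP => a12; rewrite a12 e_irr in ae.
have [w0 _ _] := meet a0 a0.1 a0D (or_introl erefl).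
have MB_fst : {in D, forall a, exists2 w, w \in MB a & w \in KB a.1}.
  by move=> a aD; apply: meet => //; left.
have MB_snd : {in D, forall a, exists2 w, w \in MB a & w \in KB a.2}.
  by move=> a aD; apply: meet => //; right.
have [ed edP] := ex_minor adj_sym KB_conn MB_conn KB_disj MB_fst MB_snd D_neq w0.
have BS_disj u v : u != v -> disjoint (mem (branch (@gadj m N F) D KB MB u))
    (mem (branch (@gadj m N F) D KB MB v)) by move=> uv; exact: branch_disj.
have BS_conn v : conn (@gadj m N F) (branch (@gadj m N F) D KB MB v) by exact: branch_conn.
have ed_in : {in D, forall a, (ed a).1 \in branch (@gadj m N F) D KB MB a.1 /\
    (ed a).2 \in branch (@gadj m N F) D KB MB a.2} by move=> a /edP[].
have ed_adj : {in D, forall a, @gadj m N F (ed a).1 (ed a).2} by move=> a /edP[].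
exact: (minor_card_le (@gadj_irr m N F) (@gtris3 m N F)
   (gtris2 F3 Fedge) (@barB m N F) (bar_closed F3) (@exact_edgesB m F) (closed_edgesD F3)
   (exact_edges0 F) (card_closed_edges surf conn_vertices euler) (fun f => exact_bar F3 N0)
   e_sym e_irr girth5 oD BS_disj BS_conn ed_in ed_adj card_cob).
Unshelve. all: by end_near.
Qed.

End EmbeddedGraph.

(** * Rank of the graph and the final estimate *)

(** A coboundary is determined by its potential on [V], and, since the trivialized arcs span, also
    by its values on them. *)
Lemma card_coboundary_on_le (V A : finType) (L : labeling V A) (tau : {ffun V -> {perm A}}) :
  (forall eta : V -> 'F_2, {in trivialized L tau, forall a, eta a.1 = eta a.2} ->
    {in L.1, forall a, eta a.1 = eta a.2}) ->
  (#|coboundary_on L.1 @: [set: {ffun V -> 'F_2}]%SET| <=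
    2 ^ minn #|trivialized L tau| #|V|)%N.
Proof.
move=> spanning; set T := trivialized L tau.
have TD a : a \in T -> a \in L.1 by rewrite inE => /andP[].
rewrite /minn; case: ifP => _; last first.
  by apply: leq_trans (leq_imset_card _ _) _; rewrite cardsT card_ffun card_ord.
pose restr (z : {ffun {a : V * V | a \in L.1} -> 'F_2}) : {ffun {a : V * V | a \in T} -> 'F_2} :=
  [ffun a => z (exist (fun a => is_true (a \in L.1)) (val a) (TD _ (valP a)))].
have -> : (2 ^ #|T| = #|[set: {ffun {a : V * V | a \in T} -> 'F_2}]|)%N.
  have cT : #|{: {a : V * V | a \in T}}| = #|T|.
    by rewrite card_sig; apply: eq_card => a; rewrite !inE.
  by rewrite cardsT card_ffun card_ord cT.
rewrite -(card_in_imset (f := restr)); first by apply: subset_leq_card; apply: finset.subsetT.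
move=> _ _ /imsetP[e1 _ ->] /imsetP[e2 _ ->] E.
have same : {in L.1, forall a, (e1 - e2) a.1 = (e1 - e2) a.2}.
  apply: spanning => a aT.
  have := congr1 (fun z : {ffun {a : V * V | a \in T} -> 'F_2} =>
     z (exist (fun a => is_true (a \in T)) a aT)) E.
  rewrite !ffunE /= => Ea; apply: addF2_eq0; rewrite addrACA Ea -opprD.
  by rewrite subrr.
apply/ffunP => a; rewrite !ffunE; apply/eqP; rewrite -subr_eq0 opprD addrACA.
by have := same _ (valP a); rewrite !ffunE => ->; rewrite addF2.
Qed.

(** The right side minus the left side is [(t - r) * (k - 3)], plus a third of the quantities in
    [h2] and [h3], plus [k - 3]. *)
Lemma exponent_le (R : realType) (n g k t d r : R) : 3 <= k -> 0 <= r -> r <= t -> r <= n ->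
  3 * d <= 5 * (r + g) ->
  (n - 5 * g) * (k - 2) / 3 - (k - 3) <= n * (k - 1) - (t + (d - t) * (k - 2)).
Proof.
move=> k3 r0 rt rn dg.
have h1 : 0 <= (t - r) * (k - 3) by rewrite mulr_ge0 ?subr_ge0.
have h2 : 0 <= (5 * (r + g) - 3 * d) * (k - 2) by rewrite mulr_ge0 ?subr_ge0 //; lra.
have h3 : 0 <= (n - r) * (2 * k - 1) by rewrite mulr_ge0 ?subr_ge0 //; lra.
lra.
Qed.

Lemma powR_le_of_expn (R : realType) (k N E d : nat) (X : R) : (1 < k)%N ->
  (k ^ E <= N ^ k.-1 * k ^ d)%N -> X * (k%:R - 1) <= E%:R - d%:R ->
  k%:R `^ X <= N%:R.
Proof.
move=> k1 le_nat leX.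
have k0 : 0 < k%:R :> R by rewrite ltr0n ltnW.
have k1R : k.-1%:R = k%:R - 1 :> R by rewrite -subn1 natrB // ltnW.
have p0 : (0 < k.-1)%N by lia.
rewrite -(ler_pXn2r p0) ?nnegrE ?powR_ge0 ?ler0n //.
rewrite -powR_mulrn ?powR_ge0 // -powRrM k1R.
apply: (@le_trans _ _ (k%:R `^ (E%:R - d%:R))).
  by apply: ler_powR => //; rewrite ler1n ltnW.
have kd : 0 < k%:R `^ d%:R :> R by rewrite powR_gt0.
rewrite -(ler_pM2r kd) -powRD; last by rewrite (gt_eqF k0) implybT.
by rewrite subrK !powR_mulrn ?ler0n // -!natrX -natrM ler_nat.
Qed.

Theorem theorem5p1 (R : realType) (V : finType) (e : rel V) (n g k : nat)
    (A : finType) (S : topologicalType)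
    (e_sym : symmetric e) (e_irr : irreflexive e) (Vn : #|V| = n)
    (girth5 : girth_ge e 5)
    (S_surface : closed_surface R S) (S_genus : Euler_genus R S g)
    (p : V -> S) (gamma : {set V} -> R -> S) (G_in_S : embedding e p gamma)
    (Ak : #|A| = k) (G_DP : DP_colorable e A)
    (k_primepow : exists q r : nat, [/\ prime q, (0 < r)%N & k = (q ^ r)%N])
    (k_gt2 : (2 < k)%N) (n_ge : (5 * g <= n)%N) :
  k%:R `^ (((n%:R - 5 * g%:R) * (k%:R - 2) / 3 - (k%:R - 3)) / (k%:R - 1))
    <= (P_DP e A)%:R :> R.
Proof.
have [L eL ->] := P_DP_attained A e_sym e_irr.
have [tau tauP] := ex_spanning_trivialized L.
have [_ _ S_conn _ _] := S_surface.
have edge_le := embedded_card_le e_sym e_irr G_in_S eL girth5 S_conn S_genus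
  (card_coboundary_on_le tauP).
have A2 : (2 < #|A|)%N by rewrite Ak.
have App : exists q r : nat, [/\ prime q, (0 < r)%N & #|A| = (q ^ r)%N] by rewrite Ak.
(* DP-colorability supplies the one nonzero of the polynomial that the Alon-Furedi bound
   presupposes. *)
have := num_colorings_ge tau App A2 (G_DP L eL).
have TD : trivialized L tau \subset L.1 by apply/fintype.subsetP => a; rewrite inE => /andP[].
have tD := subset_leq_card TD.
rewrite cardsD (finset.setIidPr TD) Ak Vn => count.
apply: powR_le_of_expn count _; first exact: ltnW.
have k3 : 3 <= k%:R :> R by rewrite ler_nat.
rewrite divfK; last by apply/eqP; lra.
rewrite natrD !natrM !natrB -?subn1 ?natrB //; try lia.
rewrite Vn in edge_le; set r := minn _ _ in edge_le.
apply: (exponent_le (r := r%:R)) => //.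
- by rewrite ler_nat geq_minl.
- by rewrite ler_nat geq_minr.
- by rewrite -natrD -!natrM ler_nat.
Qed.
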